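(* Let $\zeta\in t\cdot\mathcal A[[t]]$, where $\mathcal A=\mathbb C[q,q^{-1}]_{(q-1)}$. Then the element $$\mathcal F_{CG}=(V\otimes V)\,\exp_{q^{-2}}\!\Big(\frac{q^{-2}\,\zeta\, t}{1-q^2}\,f_2\otimes e_1\Big)\,\Delta(V^{-1}),$$ where $$V=\exp_{q^{-2}}\!\Big(-\frac{\zeta}{1-q^2}\,e_1L_1^2L_2^{-2}\Big)\cdot\exp_{q^2}\!\Big(\frac{t}{1-q^2}\,f_2\Big)\in U'_q(\mathfrak{sl}_3)[[t]],$$ restricts to a twist of $\hat U'_q(\mathfrak{sl}_3)[[t]]$; that is, $\mathcal F_{CG}$ lies in $\big(\hat U'_q(\mathfrak{sl}_3)\otimes_{\mathcal A}\hat U'_q(\mathfrak{sl}_3)\big)[[t]]$ and is a twist.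
   Context: **Twists.** For a Hopf algebra $H$ with coproduct $\Delta$ and counit $\varepsilon$ (here a $t$-adically completed one; $H=H_0[[t]]$, with $H\otimes H$ understood as $(H_0\otimes H_0)[[t]]$), a twist in $H$ is an element $\mathcal F\in H\otimes H$ with $\mathcal F^{12}(\Delta\otimes\mathrm{id})(\mathcal F)=\mathcal F^{23}(\mathrm{id}\otimes\Delta)(\mathcal F)$ and $(\varepsilon\otimes\mathrm{id})(\mathcal F)=(\mathrm{id}\otimes\varepsilon)(\mathcal F)=1$. **$q$-exponential.** $\exp_p(x)=\sum_{n\ge0}\frac{x^n}{(n)_p!}$, $(n)_p!=(1)_p(2)_p\cdots(n)_p$, $(k)_p=\frac{1-p^k}{1-p}$. **The Hopf algebra $U'_q(\mathfrak{sl}_3)$.** It is the algebra over $\mathbb C(q)$ generated by $e_i,f_i,L_i^{\pm1}$, $i=1,2$, the $L_i$ commuting, with relations $L_ie_jL_i^{-1}=q^{\delta_{ij}}e_j$, $L_if_jL_i^{-1}=q^{-\delta_{ij}}f_j$, $e_if_j-f_je_i=\delta_{ij}\frac{k_i-k_i^{-1}}{q-q^{-1}}$ where $k_1=L_1^2L_2^{-1}$, $k_2=L_1^{-1}L_2^2$, and the quantum Serre relations $e_i^2e_j-(q+q^{-1})e_ie_je_i+e_je_i^2=0$, $f_i^2f_j-(q+q^{-1})f_if_jf_i+f_jf_i^2=0$ for $i\ne j$. The coproduct is $\Delta(L_i)=L_i\otimes L_i$, $\Delta(e_1)=L_1^{-2}L_2^2\otimes e_1+e_1\otimes1$, $\Delta(e_2)=L_1L_2^{-2}\otimes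 e_2+e_2\otimes L_1$, $\Delta(f_1)=f_1\otimes L_1^2L_2^{-1}+L_2^{-1}\otimes f_1$, $\Delta(f_2)=f_2\otimes L_1^{-2}L_2^2+1\otimes f_2$; the counit is $\varepsilon(L_i)=1$, $\varepsilon(e_i)=\varepsilon(f_i)=0$. **Regular form.** $\mathcal A$ is the ring of rational functions in $q$ regular at $q=1$, and $\hat U'_q(\mathfrak{sl}_3)$ is the $\mathcal A$-subalgebra of $U'_q(\mathfrak{sl}_3)$ generated by $L_i^{-1},\frac{L_i-1}{q-1},e_i,f_i$ ($i=1,2$). *)

(* Defs.v *)
From HB Require Import structures.
From mathcomp Require Import all_boot all_order all_algebra.
From mathcomp Require Import boolp reals complex.
From mathcomp Require Import ring.

Set Implicit Arguments.
Unset Strict Implicit.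
Unset Printing Implicit Defensive.

Import GRing.Theory.
Local Open Scope ring_scope.
Local Open Scope quotient_scope.

(******************************************************************************)
(** * Tensor products *)

(** [tens A B] is the set of finite formal sums of pairs [(a, b)], two of them
    being identified when every bilinear map out of [A x B] takes the same
    value on both; [tlift] is the map induced on it by a bilinear map. *)
Section TensorModule.
Variables (K : comNzRingType) (A B : lmodType K).

Definition bilin (M : lmodType K) (phi : A -> B -> M) :=
  (forall b, linear (phi^~ b)) /\ (forall a, linear (phi a)).

Definition psum (M : lmodType K) (phi : A -> B -> M) (s : seq (A * B)) : M :=
  \sum_(p <- s) phi p.1 p.2.

Definition tens_rel (s t : seq (A * B)) : bool :=
  `[< forall (M : lmodType K) (phi : A -> B -> M),
        bilin phi -> psum phi s = psum phi t >].

Lemma tens_rel_equiv : equiv_class_of tens_rel.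
Proof.
split.
- by move=> s; apply/asboolP.
- by move=> s t; apply/asboolP/asboolP => h M phi b; rewrite h.
- move=> s t u /asboolP h1 /asboolP h2; apply/asboolP => M phi b.
  by rewrite h1 // h2.
Qed.

Canonical tens_equiv := EquivRelPack tens_rel_equiv.

Definition tens := {eq_quot tens_equiv}.
HB.instance Definition _ := Choice.on tens.
HB.instance Definition _ := EqQuotient.on tens.

Definition tlift (M : lmodType K) (phi : A -> B -> M) (x : tens) : M :=
  psum phi (repr x).

Lemma tlift_pi (M : lmodType K) (phi : A -> B -> M) s :
  bilin phi -> tlift phi (\pi_tens s) = psum phi s.
Proof.
move=> b; rewrite /tlift; have : repr (\pi_tens s) = s %[mod tens].
  by rewrite reprK.
by move=> /eqmodP/asboolP; apply.
Qed.

Lemma tensP (x y : tens) :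
  (forall (M : lmodType K) (phi : A -> B -> M),
     bilin phi -> tlift phi x = tlift phi y) -> x = y.
Proof.
move=> h; rewrite -[x]reprK -[y]reprK; apply/eqmodP/asboolP => M phi b.
exact: h.
Qed.

Section Bilin.
Variables (M : lmodType K) (phi : A -> B -> M) (bphi : bilin phi).
Lemma bilinDl a a' b : phi (a + a') b = phi a b + phi a' b.
Proof. by have := bphi.1 b 1 a a'; rewrite !scale1r. Qed.
Lemma bilinDr a b b' : phi a (b + b') = phi a b + phi a b'.
Proof. by have := bphi.2 a 1 b b'; rewrite !scale1r. Qed.
Lemma bilin0l b : phi 0 b = 0.
Proof. by apply: (addrI (phi 0 b)); rewrite -bilinDl !addr0. Qed.
Lemma bilin0r a : phi a 0 = 0.
Proof. by apply: (addrI (phi a 0)); rewrite -bilinDr !addr0. Qed.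
Lemma bilinZl k a b : phi (k *: a) b = k *: phi a b.
Proof. by have := bphi.1 b k a 0; rewrite /= bilin0l !addr0. Qed.
Lemma bilinZr k a b : phi a (k *: b) = k *: phi a b.
Proof. by have := bphi.2 a k b 0; rewrite bilin0r !addr0. Qed.
End Bilin.

Lemma psum_cat (M : lmodType K) (phi : A -> B -> M) s t :
  psum phi (s ++ t) = psum phi s + psum phi t.
Proof. by rewrite /psum big_cat. Qed.

Definition tscale_seq k (s : seq (A * B)) := [seq (k *: p.1, p.2) | p <- s].

Lemma psum_scale (M : lmodType K) (phi : A -> B -> M) k s :
  bilin phi -> psum phi (tscale_seq k s) = k *: psum phi s.
Proof.
move=> b; rewrite /psum big_map scaler_sumr.
by apply: eq_bigr => p _; rewrite /= (bilinZl b).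
Qed.

Definition tadd (x y : tens) : tens := \pi_tens (repr x ++ repr y).
Definition tzero : tens := \pi_tens [::].
Definition tscale k (x : tens) : tens := \pi_tens (tscale_seq k (repr x)).
Definition topp (x : tens) : tens := tscale (-1) x.

Lemma tlift_add (M : lmodType K) (phi : A -> B -> M) x y : bilin phi ->
  tlift phi (tadd x y) = tlift phi x + tlift phi y.
Proof. by move=> b; rewrite tlift_pi // psum_cat. Qed.
Lemma tlift_zero (M : lmodType K) (phi : A -> B -> M) : bilin phi ->
  tlift phi tzero = 0.
Proof. by move=> b; rewrite tlift_pi // /psum big_nil. Qed.
Lemma tlift_scale (M : lmodType K) (phi : A -> B -> M) k x : bilin phi ->
  tlift phi (tscale k x) = k *: tlift phi x.
Proof. by move=> b; rewrite tlift_pi // psum_scale. Qed.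

Lemma taddA : associative tadd.
Proof. by move=> x y z; apply: tensP => M phi b; rewrite !tlift_add ?addrA. Qed.
Lemma taddC : commutative tadd.
Proof. by move=> x y; apply: tensP => M phi b; rewrite !tlift_add // addrC. Qed.
Lemma tadd0 : left_id tzero tadd.
Proof.
by move=> x; apply: tensP => M phi b; rewrite tlift_add // tlift_zero // add0r.
Qed.
Lemma taddN : left_inverse tzero topp tadd.
Proof.
move=> x; apply: tensP => M phi b.
by rewrite tlift_add // tlift_scale // tlift_zero // scaleN1r addNr.
Qed.
HB.instance Definition _ := GRing.isZmodule.Build tens taddA taddC tadd0 taddN.

Lemma tscaleA k l (x : tens) : tscale k (tscale l x) = tscale (k * l) x.
Proof. by apply: tensP => M phi b; rewrite !tlift_scale // scalerA. Qed.
Lemma tscale1 : left_id 1 tscale.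
Proof. by move=> x; apply: tensP => M phi b; rewrite tlift_scale // scale1r. Qed.
Lemma tscaleDr : right_distributive tscale +%R.
Proof.
move=> k x y; apply: tensP => M phi b.
by rewrite tlift_scale // !tlift_add // !tlift_scale // scalerDr.
Qed.
Lemma tscaleDl (x : tens) : {morph tscale^~ x : k l / k + l}.
Proof.
move=> k l; apply: tensP => M phi b.
by rewrite tlift_add // !tlift_scale // scalerDl.
Qed.
HB.instance Definition _ :=
  GRing.Zmodule_isLmodule.Build K tens tscaleA tscale1 tscaleDr tscaleDl.

Lemma tlift_linear (M : lmodType K) (phi : A -> B -> M) :
  bilin phi -> linear (tlift phi).
Proof. by move=> b k x y; rewrite tlift_add // tlift_scale. Qed.

Definition pure (a : A) (b : B) : tens := \pi_tens [:: (a, b)].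

Lemma tlift_pure (M : lmodType K) (phi : A -> B -> M) a b :
  bilin phi -> tlift phi (pure a b) = phi a b.
Proof. by move=> bphi; rewrite tlift_pi // /psum big_seq1. Qed.

Lemma bilin_pure : bilin pure.
Proof.
split=> [b|a] k x y; apply: tensP => M phi bphi;
  rewrite tlift_linear // !tlift_pure //.
- by rewrite bilinDl // bilinZl.
- by rewrite bilinDr // bilinZr.
Qed.

Lemma tlift_sum (M : lmodType K) (phi : A -> B -> M) I (s : seq I)
    (x : I -> tens) : bilin phi ->
  tlift phi (\sum_(i <- s) x i) = \sum_(i <- s) tlift phi (x i).
Proof.
move=> b; elim: s => [|i s ih]; first by rewrite !big_nil tlift_zero.
by rewrite !big_cons tlift_add // ih.
Qed.

Lemma tens_sum (x : tens) : x = \sum_(p <- repr x) pure p.1 p.2.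
Proof.
apply: tensP => M phi b; rewrite tlift_sum //.
by apply: eq_bigr => p _; rewrite tlift_pure.
Qed.

Lemma tens_ind (P : tens -> Prop) :
  P 0 -> (forall a b, P (pure a b)) -> (forall x y, P x -> P y -> P (x + y)) ->
  forall x, P x.
Proof.
move=> P0 Pp PD x; rewrite (tens_sum x).
by elim/big_ind: _ => // -[a b] _; apply: Pp.
Qed.

Lemma pureDl a a' b : pure (a + a') b = pure a b + pure a' b.
Proof. exact: bilinDl bilin_pure _ _ _. Qed.
Lemma pureDr a b b' : pure a (b + b') = pure a b + pure a b'.
Proof. exact: bilinDr bilin_pure _ _ _. Qed.
Lemma pureZl k a b : pure (k *: a) b = k *: pure a b.
Proof. exact: bilinZl bilin_pure _ _ _. Qed.
Lemma pureZr k a b : pure a (k *: b) = k *: pure a b.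
Proof. exact: bilinZr bilin_pure _ _ _. Qed.
Lemma pure0l b : pure 0 b = 0.
Proof. exact: bilin0l bilin_pure _. Qed.
Lemma pure0r a : pure a 0 = 0.
Proof. exact: bilin0r bilin_pure _. Qed.
Lemma pureNl a b : pure (- a) b = - pure a b.
Proof. by rewrite -scaleN1r pureZl scaleN1r. Qed.
Lemma pureNr a b : pure a (- b) = - pure a b.
Proof. by rewrite -scaleN1r pureZr scaleN1r. Qed.

End TensorModule.

Reserved Notation "a ⊗ b" (at level 38, left associativity).
Notation "a ⊗ b" := (pure a b) : ring_scope.

Section TensorMap.
Variables (K : comNzRingType) (A A' B B' : lmodType K).

Definition tmap (f : A -> A') (g : B -> B') : tens A B -> tens A' B' :=
  tlift (fun a b => f a ⊗ g b).

Variables (f : {linear A -> A'}) (g : {linear B -> B'}).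

Lemma tmap_bilin : bilin (fun a b => f a ⊗ g b).
Proof.
by split=> [b|a] k x y; rewrite linearP ?pureDl ?pureDr ?pureZl ?pureZr.
Qed.

Lemma tmapE a b : tmap f g (a ⊗ b) = f a ⊗ g b.
Proof. exact: tlift_pure tmap_bilin. Qed.

Lemma tmap_is_linear : linear (tmap f g).
Proof. exact: tlift_linear tmap_bilin. Qed.
HB.instance Definition _ :=
  GRing.isLinear.Build K (tens A B) (tens A' B') *:%R (tmap f g) tmap_is_linear.
End TensorMap.

Section TensorAssoc.
Variables (K : comNzRingType) (A B C : lmodType K).

Definition tassoc : tens A (tens B C) -> tens (tens A B) C :=
  tlift (fun a => tlift (fun b c => a ⊗ b ⊗ c)).

Lemma tassoc_bilin_in (a : A) :
  bilin (fun (b : B) (c : C) => a ⊗ b ⊗ c).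
Proof.
by split=> [c|b] k x y; rewrite ?(pureDl, pureDr) ?(pureZl, pureZr).
Qed.

Lemma tassoc_bilin :
  @bilin K A (tens B C) _ (fun a => tlift (fun (b : B) (c : C) => a ⊗ b ⊗ c)).
Proof.
split=> [x|a]; last exact: tlift_linear (tassoc_bilin_in a).
move=> k a a'; elim/tens_ind: x => [|b c|x y hx hy].
- by rewrite !(tlift_zero (tassoc_bilin_in _)) scaler0 addr0.
- by rewrite !(tlift_pure _ _ (tassoc_bilin_in _)) !pureDl !pureZl.
- by rewrite !(tlift_add _ _ (tassoc_bilin_in _)) hx hy scalerDr addrACA.
Qed.

Lemma tassocE a b c : tassoc (a ⊗ (b ⊗ c)) = a ⊗ b ⊗ c.
Proof.
by rewrite /tassoc (tlift_pure _ _ tassoc_bilin)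
  (tlift_pure _ _ (tassoc_bilin_in _)).
Qed.

Lemma tassoc_is_linear : linear tassoc.
Proof. exact: tlift_linear tassoc_bilin. Qed.
HB.instance Definition _ :=
  GRing.isLinear.Build K (tens A (tens B C)) (tens (tens A B) C) *:%R tassoc
    tassoc_is_linear.
End TensorAssoc.

Arguments tassoc {K A B C} x.

(******************************************************************************)
(** * Bialgebras *)

(** Algebras with a counit.  [algType] asks for [1 != 0], which passes to the
    tensor product of two algebras through their counits. *)
HB.mixin Record hasCounit (K : comNzRingType) A of GRing.Algebra K A := {
  counit : A -> K;
  counit_is_scalar : scalar counit;
  counit_is_monoid_morphism : monoid_morphism counit
}.

#[short(type="augAlgType")]
HB.structure Definition AugAlgebra (K : comNzRingType) :=
  { A of hasCounit K A & GRing.Algebra K A }.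

HB.instance Definition _ (K : comNzRingType) (A : augAlgType K) :=
  GRing.isLinear.Build K A K *%R (counit : A -> K) counit_is_scalar.
HB.instance Definition _ (K : comNzRingType) (A : augAlgType K) :=
  GRing.isMonoidMorphism.Build A K (counit : A -> K) counit_is_monoid_morphism.

Section TensorAlgebra.
Variables (K : comNzRingType) (A B : augAlgType K).

Definition tmul_in (x : tens A B) (a : A) (b : B) : tens A B :=
  tlift (fun a' b' => (a * a') ⊗ (b * b')) x.
Definition tmul (y x : tens A B) : tens A B := tlift (tmul_in x) y.

Lemma tmul_bilin_in a b :
  bilin (fun (a' : A) (b' : B) => (a * a') ⊗ (b * b')).
Proof.
by split=> [b'|a'] k x y; rewrite mulrDr -scalerAr
  ?(pureDl, pureDr) ?(pureZl, pureZr).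
Qed.
Lemma tmul_bilin x : bilin (tmul_in x).
Proof.
split=> [b|a] k u v; elim/tens_ind: x => [|a' b'|x y hx hy].
- by rewrite /tmul_in !(tlift_zero (tmul_bilin_in _ _)) scaler0 addr0.
- rewrite /tmul_in !(tlift_pure _ _ (tmul_bilin_in _ _)).
  by rewrite mulrDl -scalerAl pureDl pureZl.
- rewrite /tmul_in !(tlift_add _ _ (tmul_bilin_in _ _)) -!/(tmul_in _ _ _).
  by rewrite hx hy scalerDr addrACA.
- by rewrite /tmul_in !(tlift_zero (tmul_bilin_in _ _)) scaler0 addr0.
- rewrite /tmul_in !(tlift_pure _ _ (tmul_bilin_in _ _)).
  by rewrite mulrDl -scalerAl pureDr pureZr.
- rewrite /tmul_in !(tlift_add _ _ (tmul_bilin_in _ _)) -!/(tmul_in _ _ _).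
  by rewrite hx hy scalerDr addrACA.
Qed.

Lemma tmulE a b a' b' : tmul (a ⊗ b) (a' ⊗ b') = (a * a') ⊗ (b * b').
Proof.
by rewrite /tmul (tlift_pure _ _ (tmul_bilin _)) /tmul_in
  (tlift_pure _ _ (tmul_bilin_in _ _)).
Qed.
Lemma tmulPl x k u v : tmul (k *: u + v) x = k *: tmul u x + tmul v x.
Proof. exact: tlift_linear (tmul_bilin x) k u v. Qed.
Lemma tmulPr x k u v : tmul x (k *: u + v) = k *: tmul x u + tmul x v.
Proof.
elim/tens_ind: x => [|a b|x y hx hy].
- by rewrite /tmul !(tlift_zero (tmul_bilin _)) scaler0 addr0.
- rewrite /tmul !(tlift_pure _ _ (tmul_bilin _)).
  exact: tlift_linear (tmul_bilin_in _ _) _ _ _.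
- by rewrite /tmul !(tlift_add _ _ (tmul_bilin _)) -!/(tmul _ _) hx hy
    scalerDr addrACA.
Qed.
Lemma tmulDl : left_distributive tmul +%R.
Proof. by move=> u v x; have := tmulPl x 1 u v; rewrite !scale1r. Qed.
Lemma tmulDr : right_distributive tmul +%R.
Proof. by move=> x u v; have := tmulPr x 1 u v; rewrite !scale1r. Qed.
Lemma tmul0l x : tmul 0 x = 0.
Proof. by apply: (addrI (tmul 0 x)); rewrite -tmulDl !addr0. Qed.
Lemma tmul0r x : tmul x 0 = 0.
Proof. by apply: (addrI (tmul x 0)); rewrite -tmulDr !addr0. Qed.
Lemma tmulA : associative tmul.
Proof.
move=> x y z; elim/tens_ind: x => [|a b|x x' hx hx'].
- by rewrite !tmul0l.
- elim/tens_ind: y => [|a' b'|y y' hy hy'].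
  + by rewrite tmul0l tmul0r tmul0l.
  + elim/tens_ind: z => [|a'' b''|z z' hz hz']; first by rewrite !tmul0r.
      by rewrite !tmulE !mulrA.
    by rewrite !tmulDr hz hz'.
  + by rewrite !(tmulDl, tmulDr) hy hy'.
- by rewrite !tmulDl hx hx'.
Qed.
Lemma tmul1l : left_id (1 ⊗ 1) tmul.
Proof.
move=> x; elim/tens_ind: x => [|a b|x y hx hy]; first exact: tmul0r.
  by rewrite tmulE !mul1r.
by rewrite tmulDr hx hy.
Qed.
Lemma tmul1r : right_id (1 ⊗ 1) tmul.
Proof.
move=> x; elim/tens_ind: x => [|a b|x y hx hy]; first exact: tmul0l.
  by rewrite tmulE !mulr1.
by rewrite tmulDl hx hy.
Qed.

Definition tcounit : tens A B -> K :=
  @tlift K A B K^o (fun a b => counit a * counit b).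
Lemma tcounit_bilin :
  @bilin K A B K^o (fun a b => counit a * counit b).
Proof.
split=> [b|a] k x y; rewrite linearP.
  by rewrite mulrDl -mulrA.
by rewrite mulrDr mulrCA.
Qed.
Lemma tcounitE a b : tcounit (a ⊗ b) = counit a * counit b.
Proof. exact: tlift_pure tcounit_bilin. Qed.
Lemma tcounit_is_scalar : scalar tcounit.
Proof. exact: tlift_linear tcounit_bilin. Qed.

Lemma tens_oner_neq0 : 1 ⊗ 1 != 0 :> tens A B.
Proof.
apply/negP => /eqP h; have := congr1 tcounit h.
rewrite tcounitE !rmorph1 mulr1 => /eqP.
have -> : tcounit 0 = 0 by exact: tlift_zero tcounit_bilin.
by rewrite oner_eq0.
Qed.

HB.instance Definition _ := GRing.Zmodule_isNzRing.Build (tens A B)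
  tmulA tmul1l tmul1r tmulDl tmulDr tens_oner_neq0.

Lemma tensM (a a' : A) (b b' : B) : (a ⊗ b) * (a' ⊗ b') = (a * a') ⊗ (b * b').
Proof. exact: tmulE. Qed.

Lemma tens_scalerAl k (x y : tens A B) : k *: (x * y) = (k *: x) * y.
Proof. by have := tmulPl y k x 0; rewrite tmul0l !addr0. Qed.
HB.instance Definition _ :=
  GRing.Lmodule_isLalgebra.Build K (tens A B) tens_scalerAl.
Lemma tens_scalerAr k (x y : tens A B) : k *: (x * y) = x * (k *: y).
Proof. by have := tmulPr x k y 0; rewrite tmul0r !addr0. Qed.
HB.instance Definition _ :=
  GRing.Lalgebra_isAlgebra.Build K (tens A B) tens_scalerAr.

Lemma tcounit_is_monoid_morphism : monoid_morphism tcounit.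
Proof.
split=> [|x y]; first by rewrite tcounitE !rmorph1 mulr1.
have t0 : tcounit 0 = 0 by exact: tlift_zero tcounit_bilin.
have tD u v : tcounit (u + v) = tcounit u + tcounit v.
  exact: tlift_add tcounit_bilin.
elim/tens_ind: x => [|a b|x x' hx hx']; first by rewrite mul0r t0 mul0r.
  elim/tens_ind: y => [|a' b'|y y' hy hy']; first by rewrite mulr0 t0 mulr0.
    by rewrite tensM !tcounitE !rmorphM mulrACA.
  by rewrite mulrDr !tD hy hy' mulrDr.
by rewrite mulrDl !tD hx hx' mulrDl.
Qed.
HB.instance Definition _ := hasCounit.Build K (tens A B)
  tcounit_is_scalar tcounit_is_monoid_morphism.
End TensorAlgebra.

Section TensorMapAlgebra.
Variables (K : comNzRingType) (A A' B B' : augAlgType K).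
Variables (f : {lrmorphism A -> A'}) (g : {lrmorphism B -> B'}).

Lemma tmap_is_monoid_morphism : monoid_morphism (tmap f g).
Proof.
split=> [|x y]; first by rewrite [LHS]tmapE !rmorph1.
elim/tens_ind: x => [|a b|x x' hx hx']; first by rewrite mul0r linear0 mul0r.
  elim/tens_ind: y => [|a' b'|y y' hy hy']; first by rewrite mulr0 linear0 mulr0.
    by rewrite tensM !tmapE !rmorphM tensM.
  by rewrite mulrDr !linearD /= hy hy' mulrDr.
by rewrite mulrDl !linearD /= hx hx' mulrDl.
Qed.
HB.instance Definition _ := GRing.isMonoidMorphism.Build
  (tens A B) (tens A' B') (tmap f g) tmap_is_monoid_morphism.
End TensorMapAlgebra.

Section TensorAssocAlgebra.
Variables (K : comNzRingType) (A B C : augAlgType K).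

Lemma tassoc_is_monoid_morphism : monoid_morphism (@tassoc K A B C).
Proof.
split=> [|x y]; first exact: tassocE.
elim/tens_ind: x => [|a u|x x' hx hx']; first by rewrite mul0r linear0 mul0r.
  elim/tens_ind: y => [|a' v|y y' hy hy']; first by rewrite mulr0 linear0 mulr0.
    elim/tens_ind: u => [|b c|u u' hu hu'].
    + by rewrite pure0r mul0r linear0 mul0r.
    + elim/tens_ind: v => [|b' c'|v v' hv hv'].
      * by rewrite pure0r mulr0 linear0 mulr0.
      * by rewrite !tensM !tassocE !tensM.
      * by rewrite pureDr mulrDr !linearD /= hv hv' mulrDr.
    + by rewrite pureDr mulrDl !linearD /= hu hu' mulrDl.
  by rewrite mulrDr !linearD /= hy hy' mulrDr.
by rewrite mulrDl !linearD /= hx hx' mulrDl.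
Qed.
HB.instance Definition _ := GRing.isMonoidMorphism.Build
  (tens A (tens B C)) (tens (tens A B) C) (@tassoc K A B C)
  tassoc_is_monoid_morphism.
End TensorAssocAlgebra.

Section CounitMaps.
Variables (K : comNzRingType) (H : augAlgType K).

(** [eps (x) id] and [id (x) eps], with [K (x) H] and [H (x) K] identified
    with [H] *)
Definition counitl : tens H H -> H := tlift (fun a b => counit a *: b).
Definition counitr : tens H H -> H := tlift (fun a b => counit b *: a).

Lemma counitl_bilin : bilin (fun a b : H => counit a *: b).
Proof.
split=> [b|a] k x y; first by rewrite linearP scalerDl scalerA.
by rewrite scalerDr !scalerA mulrC.
Qed.
Lemma counitr_bilin : bilin (fun a b : H => counit b *: a).
Proof.
split=> [b|a] k x y; last by rewrite linearP scalerDl scalerA.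
by rewrite scalerDr !scalerA mulrC.
Qed.
Lemma counitlE a b : counitl (a ⊗ b) = counit a *: b.
Proof. exact: tlift_pure counitl_bilin. Qed.
Lemma counitrE a b : counitr (a ⊗ b) = counit b *: a.
Proof. exact: tlift_pure counitr_bilin. Qed.
Lemma counitl_is_linear : linear counitl.
Proof. exact: tlift_linear counitl_bilin. Qed.
Lemma counitr_is_linear : linear counitr.
Proof. exact: tlift_linear counitr_bilin. Qed.
HB.instance Definition _ :=
  GRing.isLinear.Build K (tens H H) H *:%R counitl counitl_is_linear.
HB.instance Definition _ :=
  GRing.isLinear.Build K (tens H H) H *:%R counitr counitr_is_linear.

Lemma counitl_is_monoid_morphism : monoid_morphism counitl.
Proof.
split=> [|x y]; first by rewrite [LHS]counitlE rmorph1 scale1r.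
elim/tens_ind: x => [|a b|x x' hx hx']; first by rewrite mul0r linear0 mul0r.
  elim/tens_ind: y => [|a' b'|y y' hy hy']; first by rewrite mulr0 linear0 mulr0.
    by rewrite tensM !counitlE rmorphM -scalerAl -scalerAr scalerA.
  by rewrite mulrDr !linearD /= hy hy' mulrDr.
by rewrite mulrDl !linearD /= hx hx' mulrDl.
Qed.
Lemma counitr_is_monoid_morphism : monoid_morphism counitr.
Proof.
split=> [|x y]; first by rewrite [LHS]counitrE rmorph1 scale1r.
elim/tens_ind: x => [|a b|x x' hx hx']; first by rewrite mul0r linear0 mul0r.
  elim/tens_ind: y => [|a' b'|y y' hy hy']; first by rewrite mulr0 linear0 mulr0.
    by rewrite tensM !counitrE rmorphM -scalerAl -scalerAr scalerA.
  by rewrite mulrDr !linearD /= hy hy' mulrDr.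
by rewrite mulrDl !linearD /= hx hx' mulrDl.
Qed.
HB.instance Definition _ := GRing.isMonoidMorphism.Build
  (tens H H) H counitl counitl_is_monoid_morphism.
HB.instance Definition _ := GRing.isMonoidMorphism.Build
  (tens H H) H counitr counitr_is_monoid_morphism.
End CounitMaps.

Arguments counitl {K H} x.
Arguments counitr {K H} x.

HB.mixin Record hasComul (K : comNzRingType) H of AugAlgebra K H := {
  comul : H -> tens H H;
  comul_is_linear : linear comul;
  comul_is_monoid_morphism : monoid_morphism comul;
  comulA : forall x, tassoc (tmap idfun comul (comul x))
                     = tmap comul idfun (comul x);
  comul_counitl : forall x, counitl (comul x) = x;
  comul_counitr : forall x, counitr (comul x) = x
}.

#[short(type="bialgType")]
HB.structure Definition Bialgebra (K : comNzRingType) :=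
  { H of hasComul K H & AugAlgebra K H }.

HB.instance Definition _ (K : comNzRingType) (H : bialgType K) :=
  GRing.isLinear.Build K H (tens H H) *:%R (comul : H -> tens H H)
    comul_is_linear.
HB.instance Definition _ (K : comNzRingType) (H : bialgType K) :=
  GRing.isMonoidMorphism.Build H (tens H H) (comul : H -> tens H H)
    comul_is_monoid_morphism.

(******************************************************************************)
(** * Formal power series in t *)

Record fps (T : Type) := Fps { fcoef :> nat -> T }.

Lemma fpsP T (x y : fps T) : (forall m, x m = y m) -> x = y.
Proof. by case: x y => [x] [y] /= h; congr Fps; apply/funext. Qed.

HB.instance Definition _ (T : Type) := gen_eqMixin (fps T).
HB.instance Definition _ (T : Type) := gen_choiceMixin (fps T).

Definition fmap T T' (f : T -> T') (x : fps T) : fps T' :=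
  Fps (fun m => f (x m)).

Section FpsZmod.
Variable V : zmodType.
Definition fadd (x y : fps V) := Fps (fun m => x m + y m).
Definition fopp (x : fps V) := Fps (fun m => - x m).
Definition fzero : fps V := Fps (fun=> 0).
Lemma faddA : associative fadd.
Proof. by move=> x y z; apply: fpsP => m /=; rewrite addrA. Qed.
Lemma faddC : commutative fadd.
Proof. by move=> x y; apply: fpsP => m /=; rewrite addrC. Qed.
Lemma fadd0 : left_id fzero fadd.
Proof. by move=> x; apply: fpsP => m /=; rewrite add0r. Qed.
Lemma faddN : left_inverse fzero fopp fadd.
Proof. by move=> x; apply: fpsP => m /=; rewrite addNr. Qed.
HB.instance Definition _ := GRing.isZmodule.Build (fps V) faddA faddC fadd0 faddN.

Lemma fpsD (x y : fps V) m : (x + y) m = x m + y m. Proof. by []. Qed.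
Lemma fpsN (x : fps V) m : (- x) m = - x m. Proof. by []. Qed.
Lemma fps0 m : (0 : fps V) m = 0. Proof. by []. Qed.
Lemma fps_sumE I (r : seq I) (P : pred I) (x : I -> fps V) m :
  (\sum_(i <- r | P i) x i) m = \sum_(i <- r | P i) x i m.
Proof. by elim/big_rec2: _ => // i y z _ <-. Qed.
End FpsZmod.

Section FpsRing.
Variable A : nzRingType.
Definition fmul (x y : fps A) := Fps (fun m => \sum_(i < m.+1) x i * y (m - i)%N).
(** a constant series *)
Definition fpsC (a : A) := Fps (fun m => if m == 0%N then a else 0).
(** the series t *)
Definition fpsT : fps A := Fps (fun m => if m == 1%N then 1 else 0).

Lemma fmulA : associative fmul.
Proof.
move=> x y z; apply: fpsP => m /=.
transitivity (\sum_(i < m.+1) \sum_(j < m.+1 | (i <= j)%N)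
                 x i * y (j - i)%N * z (m - j)%N).
  apply: eq_bigr => i _; rewrite big_distrr /=.
  rewrite -(big_mkord xpredT (fun k => x i * (y k * z (m - i - k)%N))).
  rewrite -(big_mkord (fun j => i <= j)%N
              (fun j => x i * y (j - i)%N * z (m - j)%N)).
  rewrite (@big_cat_nat _ _ _ i 0 m.+1) //=; last exact: ltnW.
  rewrite [X in _ = X + _]big_nat_cond [X in _ = X + _]big1 ?add0r; last first.
    by move=> j /andP[/andP[_ h1] h2]; rewrite leqNgt h1 in h2.
  have := @big_addn _ 0 +%R 0 m.+1 i (fun j => i <= j)%N
            (fun j => x i * y (j - i)%N * z (m - j)%N).
  rewrite add0n => ->; rewrite subSn; last by rewrite -ltnS.
  rewrite [RHS]big_mkcond; apply: eq_big_nat => k _.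
  by rewrite leq_addl addnK mulrA -subnDA addnC.
rewrite (exchange_big_dep xpredT) //=; apply: eq_bigr => j _.
rewrite big_distrl /=.
rewrite -(big_mkord (fun i => i <= j)%N
            (fun i => x i * y (j - i)%N * z (m - j)%N)).
rewrite -(big_mkord xpredT (fun i => x i * y (j - i)%N * z (m - j)%N)).
rewrite (@big_cat_nat _ _ _ j.+1 0 m.+1) //=.
rewrite [X in _ + X]big_nat_cond [X in _ + X]big1 ?addr0; last first.
  by move=> i /andP[/andP[h1 _] h2]; rewrite ltnNge h2 in h1.
by rewrite [LHS]big_mkcond; apply: eq_big_nat => i /andP[_]; rewrite ltnS => ->.
Qed.
Lemma fmul1l : left_id (fpsC 1) fmul.
Proof.
move=> x; apply: fpsP => m /=; rewrite big_ord_recl big1 ?addr0 => [|i _].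
  by rewrite mul1r subn0.
by rewrite mul0r.
Qed.
Lemma fmul1r : right_id (fpsC 1) fmul.
Proof.
move=> x; apply: fpsP => m /=; rewrite big_ord_recr big1 /= ?add0r => [|i _].
  by rewrite subnn mulr1.
by rewrite subn_eq0 leqNgt ltn_ord mulr0.
Qed.
Lemma fmulDl : left_distributive fmul +%R.
Proof.
move=> x y z; apply: fpsP => m /=; rewrite -big_split.
by apply: eq_bigr => i _; apply: mulrDl.
Qed.
Lemma fmulDr : right_distributive fmul +%R.
Proof.
move=> x y z; apply: fpsP => m /=; rewrite -big_split.
by apply: eq_bigr => i _; apply: mulrDr.
Qed.
Lemma fone_neq0 : fpsC 1 != 0.
Proof.
by apply/eqP => /(congr1 (fun x : fps A => x 0%N))/eqP; rewrite /= oner_eq0.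
Qed.
HB.instance Definition _ := GRing.Zmodule_isNzRing.Build (fps A)
  fmulA fmul1l fmul1r fmulDl fmulDr fone_neq0.

Lemma fpsM (x y : fps A) m : (x * y) m = \sum_(i < m.+1) x i * y (m - i)%N.
Proof. by []. Qed.
Lemma fps1 m : (1 : fps A) m = if m == 0%N then 1 else 0.
Proof. by []. Qed.
Lemma fpsM_coef0 (x y : fps A) : x 0%N = 1 -> y 0%N = 1 -> (x * y) 0%N = 1.
Proof. by rewrite fpsM big_ord1 => -> ->; rewrite mulr1. Qed.
End FpsRing.

Arguments fpsT {A}.

Section FpsLmod.
Variables (K : comNzRingType) (V : lmodType K).
Definition fscale (k : K) (x : fps V) := Fps (fun m => k *: x m).
Lemma fscaleA k l (x : fps V) : fscale k (fscale l x) = fscale (k * l) x.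
Proof. by apply: fpsP => m /=; rewrite scalerA. Qed.
Lemma fscale1 : left_id 1 fscale.
Proof. by move=> x; apply: fpsP => m /=; rewrite scale1r. Qed.
Lemma fscaleDr : right_distributive fscale +%R.
Proof. by move=> k x y; apply: fpsP => m /=; rewrite scalerDr. Qed.
Lemma fscaleDl (x : fps V) : {morph fscale^~ x : k l / k + l}.
Proof. by move=> k l; apply: fpsP => m /=; rewrite scalerDl. Qed.
HB.instance Definition _ :=
  GRing.Zmodule_isLmodule.Build K (fps V) fscaleA fscale1 fscaleDr fscaleDl.

Lemma fpsZ k (x : fps V) m : (k *: x) m = k *: x m. Proof. by []. Qed.

(** [z v] for [z] in K[[t]] and a constant [v] in V *)
Definition fpsZC (z : fps K) (v : V) : fps V := Fps (fun m => z m *: v).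
End FpsLmod.

Section FpsAlg.
Variables (K : comNzRingType) (A : algType K).
Lemma fps_scalerAl k (x y : fps A) : k *: (x * y) = (k *: x) * y.
Proof.
apply: fpsP => m; rewrite fpsZ !fpsM scaler_sumr.
by apply: eq_bigr => i _; rewrite -scalerAl.
Qed.
HB.instance Definition _ :=
  GRing.Lmodule_isLalgebra.Build K (fps A) fps_scalerAl.
Lemma fps_scalerAr k (x y : fps A) : k *: (x * y) = x * (k *: y).
Proof.
apply: fpsP => m; rewrite fpsZ !fpsM scaler_sumr.
by apply: eq_bigr => i _; rewrite -scalerAr.
Qed.
HB.instance Definition _ :=
  GRing.Lalgebra_isAlgebra.Build K (fps A) fps_scalerAr.
End FpsAlg.

Section FpsTensor.
Variables (K : comNzRingType) (A B : lmodType K).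
(** the t-adically completed tensor product of two series *)
Definition ftens (x : fps A) (y : fps B) : fps (tens A B) :=
  Fps (fun m => \sum_(i < m.+1) x i ⊗ y (m - i)%N).
End FpsTensor.

(** The sum of a family with [u n] in [t^n A[[t]]]: only the [u n] with
    [n <= m] contribute to the coefficient of [t^m]. *)
Definition fps_series (V : zmodType) (u : nat -> fps V) : fps V :=
  Fps (fun m => \sum_(n < m.+1) u n m).

Lemma fps_pow_small (A : nzRingType) (x : fps A) n m :
  x 0%N = 0 -> (m < n)%N -> (x ^+ n) m = 0.
Proof.
move=> x0; elim: n m => // n ih m lt_mn; rewrite exprS fpsM.
rewrite big_ord_recl x0 mul0r add0r big1 // => i _.
rewrite ih ?mulr0 //; apply: leq_trans (lt_mn : (m <= n)%N).
by rewrite -subn_gt0 subKn // ltn_ord.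
Qed.

(** The inverse of a series with constant term 1 *)
Definition fpsV (A : nzRingType) (x : fps A) : fps A :=
  fps_series (fun n => (1 - x) ^+ n).

Lemma fpsV_trunc (A : nzRingType) (x : fps A) m i : x 0%N = 1 -> (i <= m)%N ->
  fpsV x i = (\sum_(n < m.+1) (1 - x) ^+ n) i.
Proof.
move=> x0 le_im; rewrite fps_sumE /=.
rewrite -(big_mkord xpredT (fun n => ((1 - x) ^+ n) i)).
rewrite -(big_mkord xpredT (fun n => ((1 - x) ^+ n) i)).
rewrite [RHS](@big_cat_nat _ _ _ i.+1) //= [X in _ = _ + X]big_nat
    [X in _ = _ + X]big1.
  by rewrite addr0.
move=> n /andP[lt_in _]; apply: fps_pow_small => //.
by rewrite fpsD fpsN fps1 x0 subrr.
Qed.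

Lemma fpsMV (A : nzRingType) (x : fps A) : x 0%N = 1 -> x * fpsV x = 1.
Proof.
move=> x0; apply: fpsP => m.
have -> : (x * fpsV x) m = (x * \sum_(n < m.+1) (1 - x) ^+ n) m.
  rewrite !fpsM; apply: eq_bigr => i _; congr (_ * _).
  by apply: fpsV_trunc => //; rewrite leq_subr.
have := subrX1 (1 - x) m.+1; rewrite addrAC subrr add0r mulNr => /esym/eqP.
rewrite eqr_oppLR opprB => /eqP ->; rewrite fpsD fpsN fps_pow_small ?subr0 //.
by rewrite fpsD fpsN fps1 x0 subrr.
Qed.

Lemma fpsVM (A : nzRingType) (x : fps A) : x 0%N = 1 -> fpsV x * x = 1.
Proof.
move=> x0; have v0 : fpsV x 0%N = 1 by rewrite /= big_ord1 expr0.
have h := fpsMV x0; have h' := fpsMV v0.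
transitivity (fpsV x * x * (fpsV x * fpsV (fpsV x))); first by rewrite h' mulr1.
by rewrite mulrA -(mulrA (fpsV x) x) h mulr1.
Qed.

(******************************************************************************)
(** * Twists and q-exponentials *)

(** A twist F in H[[t]], as an element of [(H (x) H)[[t]]]; the structure maps
    of H act coefficientwise, and both sides of the cocycle equation are put in
    [((H (x) H) (x) H)[[t]]]. *)
Definition is_twist (K : comNzRingType) (H : bialgType K)
    (F : fps (tens H H)) : Prop :=
  let F12 : fps (tens (tens H H) H) := fmap (fun x => x ⊗ 1) F in
  let F23 : fps (tens (tens H H) H) := fmap (fun x => tassoc (1 ⊗ x)) F in
  [/\ F12 * fmap (tmap comul idfun) F
      = F23 * fmap (fun x => tassoc (tmap idfun comul x)) F,
      fmap counitl F = 1 & fmap counitr F = 1].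

Section QExp.
Variable K : fieldType.
Definition qnum (p : K) k : K := (1 - p ^+ k) / (1 - p).
Definition qfact (p : K) n : K := \prod_(1 <= k < n.+1) qnum p k.
(** the p-exponential of a series without constant term *)
Definition qexp (A : algType K) (p : K) (x : fps A) : fps A :=
  fps_series (fun n => (qfact p n)^-1 *: x ^+ n).
End QExp.

(******************************************************************************)
(** * The algebra U'_q(sl_3) *)

Variant node := n1 | n2.
Variant Ugen := Ee of node | Ff of node | LL of node | LV of node.

Definition kron (i j : node) : nat :=
  match i, j with n1, n1 | n2, n2 => 1%N | _, _ => 0%N end.

Section Presentation.
Variables (K : fieldType) (q : K).

(** The defining relations for a family [x] of elements of an algebra, with
    [LV i] standing for the inverse of [L_i]. *)
Section Relations.
Variables (A : algType K) (x : Ugen -> A).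
Let e i := x (Ee i).
Let f i := x (Ff i).
Let L i := x (LL i).
Let L' i := x (LV i).

Definition kk (i : node) : A :=
  match i with n1 => L n1 ^+ 2 * L' n2 | n2 => L' n1 * L n2 ^+ 2 end.
Definition kkV (i : node) : A :=
  match i with n1 => L' n1 ^+ 2 * L n2 | n2 => L n1 * L' n2 ^+ 2 end.

Record Uq_rel : Prop := UqRel {
  Uq_LLV : forall i, L i * L' i = 1;
  Uq_LVL : forall i, L' i * L i = 1;
  Uq_LL : L n1 * L n2 = L n2 * L n1;
  Uq_Le : forall i j, L i * e j * L' i = q ^+ kron i j *: e j;
  Uq_Lf : forall i j, L i * f j * L' i = q ^- kron i j *: f j;
  Uq_ef : forall i j, e i * f j - f j * e i
            = ((kron i j)%:R / (q - q^-1)) *: (kk i - kkV i);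
  Uq_serre_e : forall i j, i <> j ->
    e i ^+ 2 * e j - (q + q^-1) *: (e i * e j * e i) + e j * e i ^+ 2 = 0;
  Uq_serre_f : forall i j, i <> j ->
    f i ^+ 2 * f j - (q + q^-1) *: (f i * f j * f i) + f j * f i ^+ 2 = 0
}.
End Relations.

(** Elements of [Uq] are the expressions in the generators, two of them being
    identified when the defining relations force them to be equal, that is,
    when they are equal in every algebra where the relations hold.  [Uq_relP]
    and [Ulift] below are the universal property. *)
Inductive uexpr :=
  UGen of Ugen | UConst of K | UAdd of uexpr & uexpr | UMul of uexpr & uexpr.

Fixpoint ueval (A : algType K) (x : Ugen -> A) (u : uexpr) : A :=
  match u with
  | UGen g => x g
  | UConst k => k%:A
  | UAdd u v => ueval x u + ueval x v
  | UMul u v => ueval x u * ueval x v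
  end.

HB.instance Definition _ := gen_eqMixin uexpr.
HB.instance Definition _ := gen_choiceMixin uexpr.

Definition uequiv (u v : uexpr) : bool :=
  `[< forall (A : algType K) (x : Ugen -> A),
        Uq_rel x -> ueval x u = ueval x v >].

Lemma uequiv_equiv : equiv_class_of uequiv.
Proof.
split.
- by move=> u; apply/asboolP.
- by move=> u v; apply/asboolP/asboolP => h A x r; rewrite h.
- move=> u v w /asboolP h1 /asboolP h2; apply/asboolP => A x r.
  by rewrite h1 // h2.
Qed.
Canonical uequiv_rel := EquivRelPack uequiv_equiv.

Definition Uq := {eq_quot uequiv_rel}.
HB.instance Definition _ := Choice.on Uq.
HB.instance Definition _ := EqQuotient.on Uq.

Definition Ulift (A : algType K) (x : Ugen -> A) (u : Uq) : A :=
  ueval x (repr u).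

Lemma Ulift_pi (A : algType K) (x : Ugen -> A) u :
  Uq_rel x -> Ulift x (\pi_Uq u) = ueval x u.
Proof.
move=> r; have : repr (\pi_Uq u) = u %[mod Uq] by rewrite reprK.
by move=> /eqmodP/asboolP; apply.
Qed.

Lemma UqP (u v : Uq) :
  (forall (A : algType K) (x : Ugen -> A), Uq_rel x -> Ulift x u = Ulift x v) ->
  u = v.
Proof.
move=> h; rewrite -[u]reprK -[v]reprK; apply/eqmodP/asboolP => A x r.
exact: h.
Qed.

Definition uadd (u v : Uq) : Uq := \pi_Uq (UAdd (repr u) (repr v)).
Definition umul (u v : Uq) : Uq := \pi_Uq (UMul (repr u) (repr v)).
Definition uconst (k : K) : Uq := \pi_Uq (UConst k).
Definition uscale (k : K) (u : Uq) : Uq := umul (uconst k) u.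
Definition uopp (u : Uq) : Uq := uscale (-1) u.
Definition ugen (g : Ugen) : Uq := \pi_Uq (UGen g).

Section LiftOps.
Variables (A : algType K) (x : Ugen -> A) (r : Uq_rel x).
Lemma Ulift_add u v : Ulift x (uadd u v) = Ulift x u + Ulift x v.
Proof. by rewrite Ulift_pi. Qed.
Lemma Ulift_mul u v : Ulift x (umul u v) = Ulift x u * Ulift x v.
Proof. by rewrite Ulift_pi. Qed.
Lemma Ulift_const k : Ulift x (uconst k) = k%:A.
Proof. by rewrite Ulift_pi. Qed.
Lemma Ulift_scale k u : Ulift x (uscale k u) = k *: Ulift x u.
Proof. by rewrite Ulift_mul Ulift_const -scalerAl mul1r. Qed.
Lemma Ulift_opp u : Ulift x (uopp u) = - Ulift x u.
Proof. by rewrite Ulift_scale scaleN1r. Qed.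
Lemma Ulift_gen g : Ulift x (ugen g) = x g.
Proof. by rewrite Ulift_pi. Qed.
End LiftOps.

Let simp :=
  (Ulift_add, Ulift_opp, Ulift_scale, Ulift_mul, Ulift_const, Ulift_gen).

Lemma uaddA : associative uadd.
Proof. by move=> u v w; apply: UqP => A x r; rewrite !simp // addrA. Qed.
Lemma uaddC : commutative uadd.
Proof. by move=> u v; apply: UqP => A x r; rewrite !simp // addrC. Qed.
Lemma uadd0 : left_id (uconst 0) uadd.
Proof. by move=> u; apply: UqP => A x r; rewrite !simp // scale0r add0r. Qed.
Lemma uaddN : left_inverse (uconst 0) uopp uadd.
Proof. by move=> u; apply: UqP => A x r; rewrite !simp // scale0r addNr. Qed.
HB.instance Definition _ := GRing.isZmodule.Build Uq uaddA uaddC uadd0 uaddN.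

Lemma umulA : associative umul.
Proof. by move=> u v w; apply: UqP => A x r; rewrite !simp // mulrA. Qed.
Lemma umul1 : left_id (uconst 1) umul.
Proof. by move=> u; apply: UqP => A x r; rewrite !simp // scale1r mul1r. Qed.
Lemma umulr1 : right_id (uconst 1) umul.
Proof. by move=> u; apply: UqP => A x r; rewrite !simp // scale1r mulr1. Qed.
Lemma umulDl : left_distributive umul uadd.
Proof. by move=> u v w; apply: UqP => A x r; rewrite !simp // mulrDl. Qed.
Lemma umulDr : right_distributive umul uadd.
Proof. by move=> u v w; apply: UqP => A x r; rewrite !simp // mulrDr. Qed.

Definition ucounit_gen (g : Ugen) : K^o :=
  match g with Ee _ | Ff _ => 0 | LL _ | LV _ => 1 end.
Lemma ucounit_rel : Uq_rel ucounit_gen.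
Proof.
split => //=; try by move=> *; rewrite ?mulr1.
- by move=> i j; rewrite mulr0 mul0r scaler0.
- by move=> i j; rewrite mulr0 mul0r scaler0.
- move=> i j; rewrite mulr0 subr0.
  by case: i; rewrite /= expr1n !mulr1 subrr scaler0.
- by move=> i j _; rewrite !mulr0 mul0r scaler0 subr0 addr0.
- by move=> i j _; rewrite !mulr0 mul0r scaler0 subr0 addr0.
Qed.

Definition ucounit : Uq -> K := Ulift ucounit_gen.

Lemma uone_neq0 : uconst 1 != uconst 0.
Proof.
apply/eqP => /(congr1 ucounit)/eqP; rewrite /ucounit !Ulift_const;
  try exact: ucounit_rel.
by rewrite scale1r scale0r oner_eq0.
Qed.
HB.instance Definition _ := GRing.Zmodule_isNzRing.Build Uq
  umulA umul1 umulr1 umulDl umulDr uone_neq0.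

Lemma uscaleA k l (u : Uq) : uscale k (uscale l u) = uscale (k * l) u.
Proof. by apply: UqP => A x r; rewrite !Ulift_scale // scalerA. Qed.
Lemma uscale1 : left_id 1 uscale.
Proof. by move=> u; apply: UqP => A x r; rewrite !Ulift_scale // scale1r. Qed.
Lemma uscaleDr : right_distributive uscale +%R.
Proof.
move=> k u v; apply: UqP => A x r.
by rewrite Ulift_scale // !Ulift_add // !Ulift_scale // scalerDr.
Qed.
Lemma uscaleDl (u : Uq) : {morph uscale^~ u : k l / k + l}.
Proof.
move=> k l; apply: UqP => A x r.
by rewrite Ulift_add // !Ulift_scale // scalerDl.
Qed.
HB.instance Definition _ :=
  GRing.Zmodule_isLmodule.Build K Uq uscaleA uscale1 uscaleDr uscaleDl.
Lemma uscalerAl k (u v : Uq) : k *: (u * v) = (k *: u) * v.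
Proof.
apply: UqP => A x r.
by rewrite Ulift_scale // (Ulift_mul r u v) (Ulift_mul r (uscale k u) v)
  Ulift_scale // scalerAl.
Qed.
HB.instance Definition _ := GRing.Lmodule_isLalgebra.Build K Uq uscalerAl.
Lemma uscalerAr k (u v : Uq) : k *: (u * v) = u * (k *: v).
Proof.
apply: UqP => A x r.
by rewrite Ulift_scale // (Ulift_mul r u v) (Ulift_mul r u (uscale k v))
  Ulift_scale // scalerAr.
Qed.
HB.instance Definition _ := GRing.Lalgebra_isAlgebra.Build K Uq uscalerAr.

Section LiftMorphism.
Variables (A : algType K) (x : Ugen -> A) (r : Uq_rel x).
Lemma Ulift_linear : linear (Ulift x).
Proof. by move=> k u v; rewrite Ulift_add // Ulift_scale. Qed.
Lemma Ulift_monoid_morphism : monoid_morphism (Ulift x).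
Proof.
split=> [|u v]; last exact: Ulift_mul.
by rewrite -[RHS]scale1r; apply: Ulift_const.
Qed.
End LiftMorphism.

Lemma uconstE k : uconst k = k%:A :> Uq.
Proof.
apply: UqP => A x r; rewrite Ulift_const // Ulift_scale // Ulift_const //.
by rewrite scale1r.
Qed.

Lemma Uq_ind (P : Uq -> Prop) :
  (forall g, P (ugen g)) -> (forall k : K, P k%:A) ->
  (forall u v, P u -> P v -> P (u + v)) ->
  (forall u v, P u -> P v -> P (u * v)) -> forall u, P u.
Proof.
move=> Pg Pc PD PM u; rewrite -[u]reprK.
have piD v w : \pi_Uq (UAdd v w) = \pi_Uq v + \pi_Uq w.
  by apply: UqP => A x r; rewrite Ulift_add // !Ulift_pi.
have piM v w : \pi_Uq (UMul v w) = \pi_Uq v * \pi_Uq w.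
  by apply: UqP => A x r; rewrite Ulift_mul // !Ulift_pi.
elim: (repr u) => [g|k|v hv w hw|v hv w hw]; first exact: Pg.
- by have := Pc k; rewrite -uconstE.
- by rewrite piD; apply: PD.
- by rewrite piM; apply: PM.
Qed.

Lemma Uq_relP : Uq_rel ugen.
Proof.
have E A x (r : @Uq_rel A x) : forall g, Ulift x (ugen g) = x g.
  exact: Ulift_gen.
have eX A x (r : @Uq_rel A x) u n : Ulift x (u ^+ n) = Ulift x u ^+ n.
  elim: n => [|n ih]; first by have [] := Ulift_monoid_morphism r.
  by rewrite !exprS Ulift_mul // ih.
have k1 A x (r : @Uq_rel A x) : Ulift x 1 = 1.
  by have [] := Ulift_monoid_morphism r.
have e0 A x (r : @Uq_rel A x) : Ulift x 0 = 0.
  by rewrite Ulift_const // scale0r.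
split.
- by move=> i; apply: UqP => A x r; rewrite Ulift_mul // !E // k1 // (Uq_LLV r).
- by move=> i; apply: UqP => A x r; rewrite Ulift_mul // !E // k1 // (Uq_LVL r).
- by apply: UqP => A x r; rewrite !Ulift_mul // !E // (Uq_LL r).
- move=> i j; apply: UqP => A x r.
  by rewrite Ulift_scale // !Ulift_mul // !E // (Uq_Le r).
- move=> i j; apply: UqP => A x r.
  by rewrite Ulift_scale // !Ulift_mul // !E // (Uq_Lf r).
- move=> i j; apply: UqP => A x r.
  rewrite Ulift_scale // !Ulift_add // !Ulift_opp // !Ulift_mul // !E //.
  rewrite (Uq_ef r); congr (_ *: (_ - _)).
    by case: i; rewrite /= Ulift_mul // eX // !E.
  by case: i; rewrite /= Ulift_mul // eX // !E.
- move=> i j ij; apply: UqP => A x r.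
  rewrite !Ulift_add // Ulift_opp // Ulift_scale // !Ulift_mul // !E //.
  by rewrite e0 // -(Uq_serre_e r ij).
- move=> i j ij; apply: UqP => A x r.
  rewrite !Ulift_add // Ulift_opp // Ulift_scale // !Ulift_mul // !E //.
  by rewrite e0 // -(Uq_serre_f r ij).
Qed.

Lemma ucounit_is_scalar : scalar ucounit.
Proof. exact: Ulift_linear ucounit_rel. Qed.
Lemma ucounit_is_monoid_morphism : monoid_morphism ucounit.
Proof. exact: Ulift_monoid_morphism ucounit_rel. Qed.
HB.instance Definition _ :=
  hasCounit.Build K Uq ucounit_is_scalar ucounit_is_monoid_morphism.

Lemma Uq_morph_ext (A : algType K) (f g : {lrmorphism Uq -> A}) :
  (forall x, f (ugen x) = g (ugen x)) -> f =1 g.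
Proof.
move=> h; elim/Uq_ind => [//|k|u v hu hv|u v hu hv].
- by rewrite !linearZ /= !rmorph1.
- by rewrite !linearD /= hu hv.
- by rewrite !rmorphM /= hu hv.
Qed.
End Presentation.

Arguments ugen {K q} g.

(******************************************************************************)
(** * The coproduct of U'_q(sl_3) *)

Section Qcommute.
Variables (K : fieldType) (A : algType K).
Implicit Types x y z : A.

Definition qc (c : K) x y := x * y = c *: (y * x).

Lemma qc1 x : qc 1 1 x. Proof. by rewrite /qc mul1r mulr1 scale1r. Qed.
Lemma qcid x : qc 1 x x. Proof. by rewrite /qc scale1r. Qed.
Lemma qcM c d x y z : qc c x z -> qc d y z -> qc (c * d) (x * y) z.
Proof.
rewrite /qc => h1 h2.
rewrite -[LHS]mulrA h2 -scalerAr (mulrA x) h1 -scalerAl scalerA mulrC.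
by rewrite -mulrA.
Qed.
Lemma qcV c x y : c != 0 -> qc c x y -> qc c^-1 y x.
Proof. by rewrite /qc => c0 ->; rewrite scalerA mulVf // scale1r. Qed.
Lemma qcX c x z n : qc c x z -> qc (c ^+ n) (x ^+ n) z.
Proof.
move=> h; elim: n => [|n ih]; first by rewrite !expr0; apply: qc1.
by rewrite !exprS; apply: qcM.
Qed.

Lemma qc_eq c d x y : c = d -> qc c x y -> qc d x y. Proof. by move->. Qed.
Lemma qcMr c d z x y : qc c z x -> qc d z y -> qc (c * d) z (x * y).
Proof.
rewrite /qc => h1 h2.
by rewrite [LHS]mulrA h1 -scalerAl -(mulrA x z) h2 -scalerAr scalerA mulrA.
Qed.
Lemma qcXr1 x z n : qc 1 z x -> qc 1 z (x ^+ n).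
Proof.
move=> h; elim: n => [|n ih]; first by rewrite expr0 /qc mulr1 mul1r scale1r.
by rewrite exprS -[X in qc X]mulr1; apply: qcMr.
Qed.
Lemma qcDr c z x y : qc c z x -> qc c z y -> qc c z (x + y).
Proof. by rewrite /qc mulrDr mulrDl scalerDr => -> ->. Qed.

Definition serre (s : K) x y := x ^+ 2 * y - s *: (x * y * x) + y * x ^+ 2.

Lemma serreD s x y z : serre s x (y + z) = serre s x y + serre s x z.
Proof.
rewrite /serre !(mulrDl, mulrDr) scalerDr opprD.
by rewrite !addrA [LHS](ACl (1*3*5*2*4*6)).
Qed.

Lemma lin_comb2 (s k1 k2 k3 k4 k5 k6 : K) (u v : A) :
  k1 + k2 = s * k3 -> k5 + k6 = s * k4 ->
  k1 *: u + k2 *: u - s *: (k3 *: u + k4 *: v) + (k5 *: v + k6 *: v) = 0.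
Proof.
move=> h1 h2; rewrite -!scalerDl scalerDr !scalerA h1 h2 opprD addrA subrr.
by rewrite add0r addNr.
Qed.

(** [x^2 y - s x y x + y x^2 = 0] for [x = a + b] and [y = a' + b'], when the
    a's q-commute with the b's *)
Lemma serre_mix (q : K) (a b a' b' : A) : q != 0 ->
  qc (q ^- 2) a b -> qc q a b' -> qc q a' b ->
  serre (q + q^-1) a a' = 0 -> serre (q + q^-1) b b' = 0 ->
  serre (q + q^-1) (a + b) (a' + b') = 0.
Proof.
move=> q0; rewrite /qc; set c := q ^- 2; set s := q + q^-1 => h11 h12 h21 Sa Sb.
have sE : q ^+ 2 + 1 = s * q by rewrite /s; field.
have S2 x y z : serre s (x + y) z = serre s x z + serre s y z +
    (x * y * z + y * x * z - s *: (x * z * y + y * z * x)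
     + (z * x * y + z * y * x)).
  rewrite /serre !expr2 !(mulrDl, mulrDr) !scalerDr !opprD !addrA.
  by rewrite [LHS](ACl (1*5*9*4*8*12*2*3*7*6*10*11)) /= !mulrA.
have Sab' : serre s a b' = 0.
  have t1 : a * b' * a = q *: (b' * a * a) by rewrite h12 -scalerAl.
  have t2 : a * a * b' = q ^+ 2 *: (b' * a * a).
    by rewrite -mulrA h12 -scalerAr mulrA t1 scalerA.
  rewrite /serre !expr2 t1 t2 [b' * (a * a)]mulrA scalerA.
  rewrite -[X in _ + X]scale1r -scalerBl -scalerDl.
  by rewrite addrAC sE subrr scale0r.
have Sba' : serre s b a' = 0.
  have t1 : b * a' * b = q *: (b * b * a').
    by rewrite -mulrA h21 -scalerAr mulrA.
  have t2 : a' * (b * b) = q ^+ 2 *: (b * b * a').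
    by rewrite mulrA h21 -scalerAl t1 scalerA.
  rewrite /serre !expr2 t1 t2 scalerA -[X in X - _]scale1r -scalerBl -scalerDl.
  by rewrite addrAC [1 + _]addrC sE subrr scale0r.
rewrite !serreD !S2 Sa Sb Sab' Sba' !addr0 !add0r.
have w1 : a * b * a' = c *: (b * a * a') by rewrite h11 -scalerAl.
have w2 : a * a' * b = (q * c) *: (b * a * a').
  by rewrite -mulrA h21 -scalerAr mulrA w1 scalerA.
have w3 : a' * a * b = (c * q) *: (b * a' * a).
  by rewrite -mulrA h11 -scalerAr mulrA h21 -scalerAl scalerA.
have w4 : a' * b * a = q *: (b * a' * a) by rewrite h21 -scalerAl.
have w5 : b * a * b' = q *: (b * b' * a) by rewrite -mulrA h12 -scalerAr mulrA.
have w6 : a * b * b' = (c * q) *: (b * b' * a) by rewrite h11 -scalerAl w5 scalerA.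
have w7 : b' * a * b = c *: (b' * b * a) by rewrite -mulrA h11 -scalerAr mulrA.
have w8 : a * b' * b = (q * c) *: (b' * b * a).
  by rewrite h12 -scalerAl w7 scalerA.
have X1 : a * b * a' + b * a * a' - s *: (a * a' * b + b * a' * a) +
          (a' * a * b + a' * b * a) = 0.
  have := @lin_comb2 s c 1 (q * c) 1 (c * q) q (b * a * a') (b * a' * a).
  rewrite !scale1r w1 w2 w3 w4; apply; rewrite /s /c; field.
    by rewrite q0.
  by rewrite q0.
have X2 : a * b * b' + b * a * b' - s *: (a * b' * b + b * b' * a) +
          (b' * a * b + b' * b * a) = 0.
  have := @lin_comb2 s (c * q) q 1 (q * c) c 1 (b * b' * a) (b' * b * a).
  rewrite !scale1r w5 w6 w7 w8 [_ *: (b' * b * a) + b * b' * a]addrC.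
  by apply; rewrite /s /c; field; rewrite ?q0.
by rewrite X1 X2 addr0.
Qed.
End Qcommute.

Section TensorQcommute.
Variables (K : fieldType) (A B : augAlgType K).
Lemma qcT c d (x y : A) (x' y' : B) :
  qc c x y -> qc d x' y' -> qc (c * d) (x ⊗ x') (y ⊗ y').
Proof.
by move=> h1 h2; rewrite /qc !tensM h1 h2 pureZl pureZr scalerA.
Qed.

Lemma serre_tensl s (g h : A) (x y : B) : g * h = h * g -> serre s x y = 0 ->
  serre s (g ⊗ x) (h ⊗ y) = 0.
Proof.
move=> gh; rewrite /serre !expr2 => S; rewrite !tensM.
have -> : g * h * g = g * g * h by rewrite -mulrA -gh mulrA.
have -> : h * (g * g) = g * g * h by rewrite mulrA -gh -mulrA -gh mulrA.
by rewrite -pureZr -pureNr -!pureDr S pure0r.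
Qed.
Lemma serre_tensr s (g h : B) (x y : A) : g * h = h * g -> serre s x y = 0 ->
  serre s (x ⊗ g) (y ⊗ h) = 0.
Proof.
move=> gh; rewrite /serre !expr2 => S; rewrite !tensM.
have -> : g * h * g = g * g * h by rewrite -mulrA -gh mulrA.
have -> : h * (g * g) = g * g * h by rewrite mulrA -gh -mulrA -gh mulrA.
by rewrite -pureZl -pureNl -!pureDl S pure0l.
Qed.

(** [[h (x) e + e (x) l, f (x) k + m (x) f']] *)
Lemma comm_tens (h e f m : A) (e' l k f' : B) c d :
  c != 0 -> d != 0 -> qc c h f -> qc c k e' -> qc d m e -> qc d l f' ->
  qc 1 h m -> qc 1 l k ->
  (h ⊗ e' + e ⊗ l) * (f ⊗ k + m ⊗ f') - (f ⊗ k + m ⊗ f') * (h ⊗ e' + e ⊗ l)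
  = (h * m) ⊗ (e' * f' - f' * e') + (e * f - f * e) ⊗ (l * k).
Proof.
move=> c0 d0 h1 /(qcV c0) h2 /(qcV d0) h3 h4 hm lk; rewrite !(mulrDl, mulrDr).
rewrite !tensM h1 h2 h3 h4 !(pureZl, pureZr) !scalerA mulfV // mulVf // !scale1r.
move: hm lk; rewrite /qc !scale1r => hm lk.
rewrite -hm -lk pureDr pureDl pureNr pureNl !opprD !addrA.
by rewrite [LHS](ACl (2*7*3*6*4*8*1*5)) /= !addrK.
Qed.
End TensorQcommute.

Section Comul.
Variables (K : fieldType) (q : K).
Local Notation U := (Uq q).
Local Notation e i := (ugen (Ee i) : U).
Local Notation f i := (ugen (Ff i) : U).
Local Notation L i := (ugen (LL i) : U).
Local Notation L' i := (ugen (LV i) : U).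

Definition comul_gen (g : Ugen) : tens U U :=
  match g with
  | LL i => L i ⊗ L i
  | LV i => L' i ⊗ L' i
  | Ee n1 => (L' n1 ^+ 2 * L n2 ^+ 2) ⊗ e n1 + e n1 ⊗ 1
  | Ee n2 => (L n1 * L' n2 ^+ 2) ⊗ e n2 + e n2 ⊗ L n1
  | Ff n1 => f n1 ⊗ (L n1 ^+ 2 * L' n2) + L' n2 ⊗ f n1
  | Ff n2 => f n2 ⊗ (L' n1 ^+ 2 * L n2 ^+ 2) + 1 ⊗ f n2
  end.

Hypothesis q0 : q != 0.
Let r := @Uq_relP K q.

Lemma qcLe i j : qc (q ^+ kron i j) (L i) (e j).
Proof.
rewrite /qc -[L i * e j]mulr1 -(Uq_LVL r i) mulrA (Uq_Le r) -scalerAl.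
by [].
Qed.
Lemma qcLf i j : qc (q ^- kron i j) (L i) (f j).
Proof.
rewrite /qc -[L i * f j]mulr1 -(Uq_LVL r i) mulrA (Uq_Lf r) -scalerAl.
by [].
Qed.
Lemma qcVx c i x : c != 0 -> qc c (L i) x -> qc c^-1 (L' i) x.
Proof.
rewrite /qc => c0 h.
rewrite -[L' i * x]mulr1 -(Uq_LLV r i) mulrA -(mulrA _ x).
have -> : x * L i = c^-1 *: (L i * x) by rewrite h scalerA mulVf // scale1r.
by rewrite -scalerAr mulrA (Uq_LVL r) mul1r -scalerAl.
Qed.
Lemma qcVe i j : qc (q ^- kron i j) (L' i) (e j).
Proof. by apply: qcVx (qcLe i j); rewrite expf_neq0. Qed.
Lemma qcVf i j : qc (q ^+ kron i j) (L' i) (f j).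
Proof.
rewrite -[q ^+ _]invrK; apply: qcVx (qcLf i j).
by rewrite invr_neq0 // expf_neq0.
Qed.
Lemma qcLL i j : qc 1 (L i) (L j).
Proof.
by rewrite /qc scale1r; case: i; case: j => //; rewrite (Uq_LL r).
Qed.
Lemma qcVL i j : qc 1 (L' i) (L j).
Proof. by rewrite -invr1; apply: qcVx (qcLL i j); rewrite oner_neq0. Qed.
Lemma qcLV i j : qc 1 (L i) (L' j).
Proof. by rewrite -invr1; apply: qcV (qcVL j i); rewrite oner_neq0. Qed.
Lemma qcVV i j : qc 1 (L' i) (L' j).
Proof. by rewrite -invr1; apply: qcVx (qcLV i j); rewrite oner_neq0. Qed.


Lemma comul_rel : Uq_rel q comul_gen.
Proof.
have [q0' qV0] : q != 0 /\ q^-1 != 0 by rewrite invr_eq0.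
have LLV i : L i ⊗ L i * (L' i ⊗ L' i) = 1 by rewrite tensM (Uq_LLV r).
have conj c i x : qc c (L i ⊗ L i) x ->
    L i ⊗ L i * x * (L' i ⊗ L' i) = c *: x.
  by move=> h; rewrite h -scalerAl -mulrA LLV mulr1.
have qcT1l c i (x y : U) : qc 1 (L i) x -> qc c (L i) y ->
    qc c (L i ⊗ L i) (x ⊗ y).
  by move=> h1 h2; have := qcT h1 h2; rewrite mul1r.
have qcT1r c i (x y : U) : qc c (L i) x -> qc 1 (L i) y ->
    qc c (L i ⊗ L i) (x ⊗ y).
  by move=> h1 h2; have := qcT h1 h2; rewrite mulr1.
have LV2 i j n : qc 1 (L i) (L' j ^+ n).
  by apply: qcXr1; apply: qcLV.
have LL2 i j n : qc 1 (L i) (L j ^+ n).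
  by apply: qcXr1; apply: qcLL.
have com (x y : U) : qc 1 x y -> x * y = y * x.
  by move=> h; rewrite h scale1r.
have com1 (x y z : U) : qc 1 x y -> qc 1 x z -> qc 1 x (y * z).
  by move=> h1 h2; have := qcMr h1 h2; rewrite mulr1.
have com2 (x y z : U) : qc 1 x z -> qc 1 y z -> qc 1 (x * y) z.
  by move=> h1 h2; have := qcM h1 h2; rewrite mulr1.
have com3 (x y : U) n : qc 1 x y -> qc 1 (x ^+ n) y.
  by move=> /(qcX n); rewrite expr1n.
have r1 (x : U) : qc 1 x 1 by rewrite /qc mulr1 mul1r scale1r.
have qcH1e j := qcM (qcX 2 (qcVe n1 j)) (qcX 2 (qcLe n2 j)).
have qcH1f j := qcM (qcX 2 (qcVf n1 j)) (qcX 2 (qcLf n2 j)).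
have qcH2f j := qcM (qcLf n1 j) (qcX 2 (qcVf n2 j)).
have qcK1e j := qcM (qcX 2 (qcLe n1 j)) (qcVe n2 j).
have cV : q ^- 1 != 0 by rewrite invr_eq0 expf_neq0.
have oneN0 : (1 : K) != 0 by exact: oner_neq0.
have q2 : q ^+ 2 != 0 by rewrite expf_neq0.
have q2V : q ^- 2 != 0 by rewrite invr_eq0.
have q1V : q^-1 != 0 by rewrite invr_eq0.
have l1 (x : U) : qc 1 1 x by rewrite /qc mulr1 mul1r scale1r.
have a1 : qc (q ^+ 2) (L' n1 ^+ 2 * L n2 ^+ 2) (f n1).
  by apply: qc_eq (qcH1f n1); rewrite /= invr1 expr1n mulr1.
have a2 : qc (q ^+ 2) (L n1 ^+ 2 * L' n2) (e n1).
  by apply: qc_eq (qcK1e n1); rewrite /= invr1 mulr1.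
have a3 : qc 1 (L' n2) (e n1) by apply: qc_eq (qcVe n2 n1); rewrite /= invr1.
have a4 : qc (q ^- 2) (L' n1 ^+ 2 * L n2 ^+ 2) (f n2).
  by apply: qc_eq (qcH1f n2); rewrite /= expr1n mul1r exprVn.
have a5 : qc (q ^- 2) (L' n1 ^+ 2 * L n2 ^+ 2) (e n1).
  by apply: qc_eq (qcH1e n1); rewrite /= expr1n mulr1 exprVn.
have a6 : qc q^-1 (L n1 * L' n2 ^+ 2) (f n1).
  by apply: qc_eq (qcH2f n1); rewrite /= expr1n mulr1.
have a7 : qc q^-1 (L n1 ^+ 2 * L' n2) (e n2).
  by apply: qc_eq (qcK1e n2); rewrite /= expr1n mul1r.
have a8 : qc q^-1 (L' n2) (e n2) by exact: qcVe n2 n2.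
have a9 : qc q^-1 (L n1) (f n1) by exact: qcLf n1 n1.
have a10 : qc (q ^+ 2) (L n1 * L' n2 ^+ 2) (f n2).
  by apply: qc_eq (qcH2f n2); rewrite /= invr1 mul1r.
have a11 : qc (q ^+ 2) (L' n1 ^+ 2 * L n2 ^+ 2) (e n2).
  by apply: qc_eq (qcH1e n2); rewrite /= invr1 expr1n mul1r.
have a12 : qc 1 (L n1) (f n2) by apply: qc_eq (qcLf n1 n2); rewrite /= invr1.
have b1 : qc 1 (L' n1 ^+ 2 * L n2 ^+ 2) (L' n2).
  by apply: com2; apply: com3; [exact: qcVV | exact: qcLV].
have b2 : qc 1 (L n1 * L' n2 ^+ 2) (L' n2).
  by apply: com2; [exact: qcLV | apply: com3; exact: qcVV].
have b3 : qc 1 (L n1) (L n1 ^+ 2 * L' n2).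
  by apply: com1 => //; exact: qcLV.
have b4 : qc 1 (L n1) (L' n1 ^+ 2 * L n2 ^+ 2) by exact: com1.
have V2 i : L' i ^+ 2 * L i = L' i.
  by rewrite expr2 -mulrA (Uq_LVL r) mulr1.
have V3 i : L i ^+ 2 * L' i = L i.
  by rewrite expr2 -mulrA (Uq_LLV r) mulr1.
have LV' i j := com _ _ (qcLV i j); have VV i j := com _ _ (qcVV i j).
have VL i j := com _ _ (qcVL i j).
have qcH2e j := qcM (qcLe n1 j) (qcX 2 (qcVe n2 j)).
have qcK1f j := qcM (qcX 2 (qcLf n1 j)) (qcVf n2 j).
have a13 : qc q (L n1 * L' n2 ^+ 2) (e n1).
  by apply: qc_eq (qcH2e n1); rewrite /= invr1 expr1n mulr1.
have a14 : qc (q ^- 2) (L n1 * L' n2 ^+ 2) (e n2).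
  by apply: qc_eq (qcH2e n2); rewrite /= mul1r exprVn.
have a15 : qc q^-1 (e n1) (L n1) by apply: qcV (qcLe n1 n1).
have a16 : qc 1 (e n2) (L n1) by rewrite -invr1; apply: qcV (qcLe n1 n2).
have a17 : qc (q ^- 2) (L n1 ^+ 2 * L' n2) (f n1).
  by apply: qc_eq (qcK1f n1); rewrite /= mulr1 exprVn.
have a18 : qc q (L n1 ^+ 2 * L' n2) (f n2).
  by apply: qc_eq (qcK1f n2); rewrite /= invr1 expr1n mul1r.
have a19 : qc 1 (f n1) (L' n2) by rewrite -invr1; apply: qcV (qcVf n2 n1).
have a20 : qc q^-1 (f n2) (L' n2) by apply: qcV (qcVf n2 n2).
have qqV : q ^+ 2 * q^-1 = q by rewrite expr2 mulfK.
have qVq : q^-1 * q ^+ 2 = q by rewrite mulrC.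
have c12 : L' n1 ^+ 2 * L n2 ^+ 2 * (L n1 * L' n2 ^+ 2)
         = L n1 * L' n2 ^+ 2 * (L' n1 ^+ 2 * L n2 ^+ 2).
  apply: com; apply: com2; apply: com3.
    by apply: com1; [exact: qcVL | apply: qcXr1; exact: qcVV].
  by apply: com1; [exact: qcLL | apply: qcXr1; exact: qcLV].
have d12 : L n1 ^+ 2 * L' n2 * (L' n1 ^+ 2 * L n2 ^+ 2)
         = L' n1 ^+ 2 * L n2 ^+ 2 * (L n1 ^+ 2 * L' n2).
  apply: com; apply: com2; [apply: com3; apply: com1 => //|].
  by apply: com1; apply: qcXr1; [exact: qcVV | exact: qcVL].
have Se i j : i <> j -> serre (q + q^-1) (e i) (e j) = 0 by exact: (Uq_serre_e r).
have Sf i j : i <> j -> serre (q + q^-1) (f i) (f j) = 0 by exact: (Uq_serre_f r).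
split.
- by move=> i /=; rewrite tensM (Uq_LLV r).
- by move=> i /=; rewrite tensM (Uq_LVL r).
- by rewrite /= !tensM (Uq_LL r).
- move=> i j; apply: conj; case: j; apply: qcDr => /=.
  + by apply: qcT1l (qcLe i n1); apply: com1.
  + by apply: qcT1r (qcLe i n1) _.
  + by apply: qcT1l (qcLe i n2); apply: com1; rewrite ?expr1; try exact: qcLL.
  + by apply: qcT1r (qcLe i n2) _; apply: qcLL.
- move=> i j; apply: conj; case: j; apply: qcDr => /=.
  + by apply: qcT1r (qcLf i n1) _; apply: com1 => //; apply: qcLV.
  + by apply: qcT1l (qcLf i n1); apply: qcLV.
  + by apply: qcT1r (qcLf i n2) _; apply: com1.
  + by apply: qcT1l (qcLf i n2).
- have gl : forall i, kk comul_gen i = kk ugen i ⊗ kk (ugen : _ -> U) i.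
    by case; rewrite /= !expr2 !tensM.
  have glV : forall i, kkV comul_gen i = kkV ugen i ⊗ kkV (ugen : _ -> U) i.
    by case; rewrite /= !expr2 !tensM.
  have HV : forall i : node, 1 / (q - q^-1) *: (kk ugen i - kkV (ugen : _ -> U) i)
      = e i * f i - f i * e i.
    by move=> i; rewrite (Uq_ef r); case: i.
  have E0 : forall i j, kron i j = 0%N -> e i * f j - f j * e i = 0.
    by move=> i j h; rewrite (Uq_ef r) h mul0r scale0r.
  have fin (i : node) (k kV X : U) c :
      X = c *: (k - kV) -> kV ⊗ X + X ⊗ k = c *: (k ⊗ k - kV ⊗ kV).
    move=> ->; rewrite pureZl pureZr -scalerDr pureDl pureDr pureNl pureNr.
    by rewrite addrC addrA addrNK.
  case; case; rewrite gl glV [_ (Ee _)]/= [_ (Ff _)]/=.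
  + rewrite (comm_tens q2 oneN0 a1 a2 a3 (l1 _) b1 (l1 _)).
    rewrite -mulrA V3 mul1r; apply: (fin n1); exact: (Uq_ef r).
  + rewrite (comm_tens q2V oneN0 a4 a5 (l1 _) (l1 _) (r1 _) (l1 _)).
    by rewrite !E0 // pure0l pure0r addr0 mul0r scale0r.
  + rewrite (comm_tens q1V q1V a6 a7 a8 a9 b2 b3).
    by rewrite !E0 // pure0l pure0r addr0 mul0r scale0r.
  + rewrite (comm_tens q2 oneN0 a10 a11 (l1 _) a12 (r1 _) b4).
    have -> : L n1 * (L' n1 ^+ 2 * L n2 ^+ 2) = kk ugen n2.
      by rewrite mulrA expr2 mulrA (Uq_LLV r) mul1r.
    rewrite mulr1; apply: (fin n2); exact: (Uq_ef r).
- case; case => // ij; apply: (serre_mix q0).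
  + by apply: qc_eq (qcT a5 (r1 _)); rewrite mulr1.
  + by apply: qc_eq (qcT a11 a15).
  + by apply: qc_eq (qcT a13 (r1 _)); rewrite mulr1.
  + exact: serre_tensl c12 (Se _ _ ij).
  + by apply: serre_tensr (Se _ _ ij); rewrite mulr1 mul1r.
  + by apply: qc_eq (qcT a14 a16); rewrite mulr1.
  + by apply: qc_eq (qcT a13 (r1 _)); rewrite mulr1.
  + by apply: qc_eq (qcT a11 a15).
  + exact: serre_tensl (esym c12) (Se _ _ ij).
  + by apply: serre_tensr (Se _ _ ij); rewrite mulr1 mul1r.
- case; case => // ij; apply: (serre_mix q0).
  + by apply: qc_eq (qcT a19 a17); rewrite mul1r.
  + by apply: qc_eq (qcT (r1 _) a18); rewrite mul1r.
  + by apply: qc_eq (qcT a20 a1).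
  + exact: serre_tensr d12 (Sf _ _ ij).
  + by apply: serre_tensl (Sf _ _ ij); rewrite mulr1 mul1r.
  + by apply: qc_eq (qcT (r1 _) a4); rewrite mul1r.
  + by apply: qc_eq (qcT a20 a1).
  + by apply: qc_eq (qcT (r1 _) a18); rewrite mul1r.
  + exact: serre_tensr (esym d12) (Sf _ _ ij).
  + by apply: serre_tensl (Sf _ _ ij); rewrite mulr1 mul1r.
Qed.
End Comul.

Section ComulAxioms.
Variables (K : fieldType) (q : K).
Local Notation U := (Uq q).

Section Morphism.
Variables (D : {lrmorphism U -> tens U U}).
Hypothesis Dgen : forall g, D (ugen g) = comul_gen q g.

Let Egen g : counit (ugen g : U) = ucounit_gen K g.
Proof. exact: Ulift_gen (ucounit_rel q) g. Qed.

Lemma Dcoassoc x : tassoc (tmap idfun D (D x)) = tmap D idfun (D x).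
Proof.
have := @Uq_morph_ext K q _ (tassoc \o (tmap idfun D \o D)) (tmap D idfun \o D).
apply => {x} g; rewrite [LHS]/= [RHS]/= Dgen.
case: g => [[]|[]|i|i]; rewrite [comul_gen _ _]/= ?linearD /= !tmapE
  /= ?(rmorphM D) ?(rmorphXn D) ?(rmorph1 D) !Dgen /= ?expr2 ?tensM
  ?(pureDl, pureDr) ?linearD /= ?tassocE ?addrA //.
all: by rewrite !Dgen /= !tensM ?tassocE.
Qed.

Lemma Dcounitl x : counitl (D x) = x.
Proof.
have := @Uq_morph_ext K q _ (counitl \o D) idfun.
apply => {x} g; rewrite [LHS]/= [RHS]/= Dgen.
case: g => [[]|[]|i|i]; rewrite [comul_gen _ _]/= ?linearD /= !counitlE;
  rewrite ?rmorphM ?rmorphXn ?rmorph1 /= ?Egen /= ?expr1n ?mulr1;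
  by rewrite ?scale1r ?scale0r ?add0r ?addr0.
Qed.

Lemma Dcounitr x : counitr (D x) = x.
Proof.
have := @Uq_morph_ext K q _ (counitr \o D) idfun.
apply => {x} g; rewrite [LHS]/= [RHS]/= Dgen.
case: g => [[]|[]|i|i]; rewrite [comul_gen _ _]/= ?linearD /= !counitrE;
  rewrite ?rmorphM ?rmorphXn ?rmorph1 /= ?Egen /= ?expr1n ?mulr1;
  by rewrite ?scale1r ?scale0r ?add0r ?addr0.
Qed.
End Morphism.

Hypothesis q0 : q != 0.
Let r := comul_rel q0.

Definition ucomul : U -> tens U U := Ulift (comul_gen q).

Lemma ucomul_is_linear : linear ucomul.
Proof. exact: Ulift_linear r. Qed.
Lemma ucomul_is_monoid_morphism : monoid_morphism ucomul.
Proof. exact: Ulift_monoid_morphism r. Qed.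

Let D : {lrmorphism U -> tens U U} := HB.pack ucomul
  (GRing.isLinear.Build K U (tens U U) *:%R ucomul ucomul_is_linear)
  (GRing.isMonoidMorphism.Build U (tens U U) ucomul ucomul_is_monoid_morphism).

Let Dgen g : D (ugen g) = comul_gen q g. Proof. exact: Ulift_gen r _. Qed.

Lemma ucomulA x : tassoc (tmap idfun ucomul (ucomul x))
                  = tmap ucomul idfun (ucomul x).
Proof. exact: Dcoassoc Dgen x. Qed.
Lemma ucomul_counitl x : counitl (ucomul x) = x.
Proof. exact: Dcounitl Dgen x. Qed.
Lemma ucomul_counitr x : counitr (ucomul x) = x.
Proof. exact: Dcounitr Dgen x. Qed.
End ComulAxioms.

HB.instance Definition _ (K : fieldType) (q : {x : K | x != 0}) :=
  hasComul.Build K (Uq (val q))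
    (ucomul_is_linear (valP q)) (ucomul_is_monoid_morphism (valP q))
    (ucomulA (valP q)) (ucomul_counitl (valP q)) (ucomul_counitr (valP q)).

Section RegularForm.
Variables (K : fieldType) (qs : {x : K | x != 0}) (S : K -> Prop).
Local Notation q := (val qs).
Local Notation U := (Uq q).
Local Notation e i := (ugen (Ee i) : U).
Local Notation f i := (ugen (Ff i) : U).
Local Notation L i := (ugen (LL i) : U).
Local Notation L' i := (ugen (LV i) : U).


(** The S-subalgebra of U generated by G, for a subring S of K *)
Inductive subalg (G : U -> Prop) : U -> Prop :=
| subalg_gen u of G u : subalg G u
| subalg_const a of S a : subalg G a%:A
| subalg_add u v of subalg G u & subalg G v : subalg G (u + v)
| subalg_mul u v of subalg G u & subalg G v : subalg G (u * v).

Inductive Uhat_gen : U -> Prop :=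
| Uhat_e i : Uhat_gen (e i)
| Uhat_f i : Uhat_gen (f i)
| Uhat_LV i : Uhat_gen (L' i)
| Uhat_L i : Uhat_gen ((q - 1)^-1 *: (L i - 1)).

Definition Uhat : U -> Prop := subalg Uhat_gen.

(** The image in [U (x) U] of the tensor product of [Uhat] with itself over S.
    For S the local ring of C(q) at [q = 1], a discrete valuation ring, [Uhat]
    is torsion-free, hence flat, and the tensor product embeds in [U (x) U]. *)
Definition Uhat2 (x : tens U U) : Prop :=
  exists2 s : seq (U * U), (forall p, p \in s -> Uhat p.1 /\ Uhat p.2)
                         & x = \sum_(p <- s) p.1 ⊗ p.2.

(** [z] belongs to t S[[t]] *)
Definition in_tS (z : fps K) : Prop :=
  exists2 y : fps K, (forall m, S (y m)) & z = fpsT * y.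

Definition VCG (zeta : fps K) : fps U :=
  qexp (q ^- 2) (- fpsZC zeta ((1 - q ^+ 2)^-1 *: (e n1 * L n1 ^+ 2 * L' n2 ^+ 2)))
  * qexp (q ^+ 2) (fpsZC fpsT ((1 - q ^+ 2)^-1 *: f n2)).

Definition FCG (zeta : fps K) : fps (tens U U) :=
  ftens (VCG zeta) (VCG zeta)
  * qexp (q ^- 2)
      (fpsZC (zeta * fpsT) ((q ^- 2 / (1 - q ^+ 2)) *: (f n2 ⊗ e n1)))
  * fmap comul (fpsV (VCG zeta)).

Lemma qexp0 (A : algType K) p (x : fps A) : qexp p x 0%N = 1.
Proof.
by rewrite [LHS]big_ord1 fpsZ expr0 fps1 /qfact big_geq // invr1 scale1r.
Qed.

(** so that [fpsV (VCG zeta)] is the inverse of [VCG zeta], by [fpsMV] and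
    [fpsVM] *)
Lemma VCG0 zeta : VCG zeta 0%N = 1.
Proof. exact: fpsM_coef0 (qexp0 _ _) (qexp0 _ _). Qed.

(** [Uhat] is a sub-bialgebra over S. *)
Section SubBialgebra.
Hypotheses (S0 : S 0) (S1 : S 1) (Sq : S q).
Hypotheses (SN : forall x, S x -> S (- x)).
Hypotheses (SD : forall x y, S x -> S y -> S (x + y)).
Hypotheses (SM : forall x y, S x -> S y -> S (x * y)).
Hypothesis q1 : q - 1 != 0.

Let q0 : q != 0 := valP qs.

Lemma Uhat1 : Uhat 1.
Proof. by rewrite -[1]scale1r; apply/subalg_const/S1. Qed.
Lemma UhatX u n : Uhat u -> Uhat (u ^+ n).
Proof.
move=> hu; elim: n => [|n ih]; first by rewrite expr0; apply: Uhat1.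
by rewrite exprS; apply: subalg_mul.
Qed.
Lemma UhatZ a u : S a -> Uhat u -> Uhat (a *: u).
Proof.
move=> ha hu; rewrite -[u]mul1r scalerAl; apply: subalg_mul => //.
exact: subalg_const.
Qed.
Lemma Uhat_LL i : Uhat (L i).
Proof.
have -> : L i = 1 + (q - 1) *: ((q - 1)^-1 *: (L i - 1)).
  by rewrite scalerA mulfV ?q1 // scale1r addrC subrK.
apply: subalg_add; first exact: Uhat1.
apply: UhatZ; last exact: subalg_gen (Uhat_L i).
by apply: SD Sq _; apply: SN.
Qed.

Lemma Uhat2_pure u v : Uhat u -> Uhat v -> Uhat2 (u ⊗ v).
Proof.
move=> hu hv; exists [:: (u, v)]; last by rewrite big_seq1.
by move=> p; rewrite inE => /eqP ->.
Qed.
Lemma Uhat2D x y : Uhat2 x -> Uhat2 y -> Uhat2 (x + y).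
Proof.
move=> [s hs ->] [t ht ->]; exists (s ++ t); last by rewrite big_cat.
by move=> p; rewrite mem_cat => /orP[/hs|/ht].
Qed.
Lemma Uhat2_sum I (s : seq I) (F : I -> tens U U) :
  (forall i, Uhat2 (F i)) -> Uhat2 (\sum_(i <- s) F i).
Proof.
move=> h; elim/big_rec: _ => [|i x _ hx]; last exact: Uhat2D.
by exists [::]; rewrite ?big_nil.
Qed.
Lemma Uhat2M x y : Uhat2 x -> Uhat2 y -> Uhat2 (x * y).
Proof.
move=> [s hs ->] [t ht ->]; rewrite big_distrl /=.
elim: s hs => [|p s ih] hs; first by exists [::]; rewrite ?big_nil.
rewrite big_cons; apply: Uhat2D; last first.
  by apply: ih => p' hp'; apply: hs; rewrite inE hp' orbT.
have [hp1 hp2] := hs p (mem_head _ _); rewrite big_distrr /= => {hs ih s}.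
elim: t ht => [|p' t ih] ht; first by exists [::]; rewrite ?big_nil.
rewrite big_cons; apply: Uhat2D; last first.
  by apply: ih => p'' h; apply: ht; rewrite inE h orbT.
have [hp1' hp2'] := ht p' (mem_head _ _).
by rewrite tensM; apply: Uhat2_pure; apply: subalg_mul.
Qed.

Lemma comul_ugen g : comul (ugen g : U) = comul_gen q g :> tens U U.
Proof. exact: Ulift_gen (comul_rel q0) g. Qed.
Lemma counit_ugen g : counit (ugen g : U) = ucounit_gen K g.
Proof. exact: Ulift_gen (ucounit_rel q) g. Qed.

Lemma Uhat_comul u : Uhat u -> Uhat2 (comul u).
Proof.
have hL i := Uhat_LL i.
have hV i : Uhat (L' i) by exact: subalg_gen (Uhat_LV i).
have he i : Uhat (e i) by exact: subalg_gen (Uhat_e i).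
have hf i : Uhat (f i) by exact: subalg_gen (Uhat_f i).
have h1 := Uhat1.
have hM x y : Uhat x -> Uhat y -> Uhat (x * y) by exact: subalg_mul.
elim=> {u} [u|a ha|u v _ hu _ hv|u v _ hu _ hv].
- case=> i; rewrite ?linearZ ?linearB /= ?rmorph1 comul_ugen.
  + by case: i => /=; apply: Uhat2D; apply: Uhat2_pure => //; apply: hM => //;
      apply: UhatX.
  + by case: i => /=; apply: Uhat2D; apply: Uhat2_pure => //; apply: hM => //;
      apply: UhatX.
  + exact: Uhat2_pure.
  + have -> : (q - 1)^-1 *: (comul_gen q (LL i) - 1)
      = ((q - 1)^-1 *: (L i - 1)) ⊗ L i + 1 ⊗ ((q - 1)^-1 *: (L i - 1)).
      rewrite pureZl pureZr -scalerDr; congr (_ *: _).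
      by rewrite /= pureDl pureDr pureNl pureNr addrA subrK.
    have hl : Uhat ((q - 1)^-1 *: (L i - 1)) by exact: subalg_gen (Uhat_L i).
    by apply: Uhat2D; apply: Uhat2_pure.
- rewrite linearZ /= rmorph1 -[a *: 1]pureZl; apply: Uhat2_pure => //.
  exact: subalg_const.
- by rewrite linearD; apply: Uhat2D.
- by rewrite rmorphM; apply: Uhat2M.
Qed.

Lemma Uhat_counit u : Uhat u -> S (counit u).
Proof.
elim=> {u} [u|a ha|u v _ hu _ hv|u v _ hu _ hv].
- case=> i; rewrite ?linearZ ?linearB /= ?rmorph1 counit_ugen /=;
    rewrite ?subrr ?mulr0; first [exact: S0 | exact: S1].
- by rewrite linearZ /= rmorph1 mulr1.
- by rewrite linearD; apply: SD.
- by rewrite rmorphM; apply: SM.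
Qed.

End SubBialgebra.
End RegularForm.

(******************************************************************************)
(** * The base field C(q) *)

Local Notation "x %:F" := (tofrac x).

(** [R[i]] is the field of complex numbers. *)
Section Cq.
Variable R : realType.

Definition Cq : fieldType := {fraction {poly R[i]}}.

Lemma qvar_neq0 : ('X : {poly R[i]})%:F != 0 :> Cq.
Proof. by rewrite tofrac_eq0 polyX_eq0. Qed.

Definition qvar : {x : Cq | x != 0} :=
  exist (fun x : Cq => x != 0) _ qvar_neq0.

(** The rational functions regular at [q = 1] *)
Definition regular1 (x : Cq) : Prop :=
  exists n d : {poly R[i]}, d.[1] != 0 /\ x = n%:F / d%:F.

Lemma regular1_poly (p : {poly R[i]}) : regular1 p%:F.
Proof. by exists p, 1; rewrite hornerC oner_eq0 rmorph1 divr1. Qed.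
Lemma regular1M x y : regular1 x -> regular1 y -> regular1 (x * y).
Proof.
move=> [n [d [d1 ->]]] [n' [d' [d1' ->]]]; exists (n * n'), (d * d').
by rewrite hornerM mulf_neq0 // !rmorphM /= invfM mulrACA.
Qed.
Lemma regular1D x y : regular1 x -> regular1 y -> regular1 (x + y).
Proof.
have nz (d : {poly R[i]}) : d.[1] != 0 -> d%:F != 0 :> Cq.
  by rewrite tofrac_eq0; apply: contraNneq => ->; rewrite horner0.
move=> [n [d [d1 ->]]] [n' [d' [d1' ->]]].
exists (n * d' + n' * d), (d * d'); rewrite hornerM mulf_neq0 //; split=> //.
by rewrite rmorphD !rmorphM /= addf_div // nz.
Qed.
Lemma regular1N x : regular1 x -> regular1 (- x).
Proof.
by move=> [n [d [d1 ->]]]; exists (- n), d; split; rewrite // rmorphN mulNr.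
Qed.
Lemma regular1_0 : regular1 0.
Proof. by rewrite -(rmorph0 (@tofrac {poly R[i]})); apply: regular1_poly. Qed.
Lemma regular1_1 : regular1 1.
Proof. by rewrite -(rmorph1 (@tofrac {poly R[i]})); apply: regular1_poly. Qed.
Lemma regular1_q : regular1 (val qvar).
Proof. exact: regular1_poly. Qed.
Lemma qvar_neq1 : val qvar - 1 != 0.
Proof.
have -> : val qvar - 1 = ('X - 1%:P : {poly R[i]})%:F by rewrite rmorphB rmorph1.
by rewrite tofrac_eq0 polyXsubC_eq0.
Qed.

Lemma Uhat_sub_bialgebra (u : Uq (val qvar)) : Uhat regular1 u ->
  Uhat2 regular1 (comul u) /\ regular1 (counit u).
Proof.
move=> hu; split.
- exact: (Uhat_comul regular1_1 regular1_q regular1N regular1D qvar_neq1 hu).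
- exact: (Uhat_counit regular1_0 regular1_1 regular1D regular1M hu).
Qed.
End Cq.

(* Main.v *)
Require Import Defs.
From HB Require Import structures.
From mathcomp Require Import all_boot all_order all_algebra.
From mathcomp Require Import boolp reals complex.
From mathcomp Require Import ring.

Set Implicit Arguments.
Unset Strict Implicit.
Unset Printing Implicit Defensive.

Import GRing.Theory.
Local Open Scope ring_scope.

(** Put [p = q^-2], [e = e_1], [f = f_2], [h = L_1^-2 L_2^2] and [E = e h^-1],
    so that [h e = p e h], [h f = p f h], [e f = f e], [e] and [f] are
    skew-primitive for [h], and [V = exp_p(- x) exp_{1/p}(y)] with
    [x = zeta E / (1 - q^2)] and [y = t f / (1 - q^2)].

    Twist: F_CG is the gauge transform by V of [exp_p(c f (x) e)].  The latter
    is a twist for every c, as the addition formula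
    [exp_p(a + b) = exp_p(a) exp_p(b)], for [b a = p a b], turns both sides of
    the cocycle equation into a product of the same three exponentials.

    Regularity: write [x1], [y1] for x and y in the first tensor factor, h for
    [1 (x) h], and d for the regular series with
    [exp_p(- x1) y1 = d y1 exp_p(- x1)].  Moving [exp_p(- 1 (x) x)] through the
    middle factors, all poles in the second tensor factor cancel, and
    [F_CG = (exp_{1/p}(d y1) exp_p(- d y1 h)) (exp_p(- x1) exp_{1/p}(x1 h^-1))].
    Each of the two factors has the form [exp_p(u g) exp_p(u)^-1] up to
    inverting p, and this equals
    [sum_n u^n (g - 1) (g - p) ... (g - p^(n-1)) / (n)_p!]; the poles of [u^n]
    are compensated by the n factors [g - p^k], all divisible by [q - 1]. *)

(** * Power series in t and q-factorials *)

Section FpsOrder.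
Variable A : nzRingType.
Implicit Types (x y z : fps A) (u v : nat -> fps A).

Definition fps_order_ge n x := forall m, (m < n)%N -> x m = 0.

Lemma fps_order_geM i j x y :
  fps_order_ge i x -> fps_order_ge j y -> fps_order_ge (i + j) (x * y).
Proof.
move=> xi yj m lt_m; rewrite fpsM big1 // => k _.
have [/xi->|le_ik] := ltnP k i; first by rewrite mul0r.
rewrite yj ?mulr0 // ltn_subLR; last by rewrite -ltnS ltn_ord.
by apply: leq_trans lt_m _; rewrite leq_add2r.
Qed.

Lemma fps_series_trunc u m i : (forall n, fps_order_ge n (u n)) -> (i <= m)%N ->
  fps_series u i = (\sum_(n < m.+1) u n) i.
Proof.
move=> hu le_im; rewrite fps_sumE /=.
rewrite -!(big_mkord xpredT (fun n => u n i)).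
rewrite [RHS](@big_cat_nat _ _ _ i.+1) //= [X in _ = _ + X]big_nat
    [X in _ = _ + X]big1 ?addr0 // => n /andP[lt_in _].
exact: hu.
Qed.

(** Both sides run over the pairs [(i, j)] with [i + j <= m]; the left one groups them by
    [n = i + j]. The order of summation is exchanged, then [n] is shifted by [i]. *)
Lemma sum_triangle (V : zmodType) (F : nat -> nat -> V) m :
  \sum_(n < m.+1) \sum_(i < n.+1) F i (n - i)%N
  = \sum_(i < m.+1) \sum_(j < m.+1 | (i + j <= m)%N) F i j.
Proof.
transitivity (\sum_(n < m.+1) \sum_(i < m.+1 | (i <= n)%N) F i (n - i)%N).
  apply: eq_bigr => n _.
  by rewrite (big_ord_widen_cond m.+1 xpredT (fun i => F i (n - i)%N)).
rewrite (exchange_big_dep xpredT) //=; apply: eq_bigr => i _.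
rewrite -(big_mkord (fun n => i <= n)%N (fun n => F i (n - i)%N)).
rewrite -(big_mkord (fun j => i + j <= m)%N (F i)).
rewrite (@big_cat_nat _ _ _ i 0 m.+1) //=; last exact: ltnW.
rewrite big_nat_cond big1 ?add0r; last first.
  by move=> j /andP[/andP[_ h1] h2]; rewrite leqNgt h1 in h2.
rewrite -{1}[nat_of_ord i]add0n big_addn
  [RHS](@big_cat_nat _ _ _ (m.+1 - i)) //=;
  last exact: leq_subr.
rewrite [X in _ = _ + X]big_nat_cond [X in _ = _ + X]big1 ?addr0; last first.
  move=> j /andP[/andP[h1 _] h2].
  by rewrite leq_subLR ltnNge h2 in h1.
rewrite big_nat_cond [RHS]big_nat_cond; apply: eq_big => [j|j _];
  last by rewrite addnK.
rewrite leq_addl andbT /=; case: ltnP => //= h.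
by rewrite -ltnS -ltn_subRL h.
Qed.

(** The coefficient of t^m sees only the first [m.+1] terms of each series, so the product becomes a
    finite double sum. Its terms with [i + j > m] vanish by their order, which cuts the square of
    indices down to the triangle of [sum_triangle]. *)
Lemma fps_seriesM u v :
  (forall n, fps_order_ge n (u n)) -> (forall n, fps_order_ge n (v n)) ->
  fps_series u * fps_series v
  = fps_series (fun n => \sum_(i < n.+1) u i * v (n - i)%N).
Proof.
move=> hu hv; apply: fpsP => m.
have -> : (fps_series u * fps_series v) m
    = ((\sum_(n < m.+1) u n) * (\sum_(n < m.+1) v n)) m.
  rewrite !fpsM; apply: eq_bigr => i _.
  rewrite (@fps_series_trunc u m) ?(@fps_series_trunc v m) ?leq_subr //.
  by rewrite -ltnS.
rewrite big_distrl fps_sumE.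
under [RHS]eq_bigr do rewrite fps_sumE.
rewrite (sum_triangle (fun i j => (u i * v j) m)); apply: eq_bigr => i _.
rewrite big_distrr fps_sumE [RHS]big_mkcond; apply: eq_bigr => j _.
by case: leqP => // lt_m; apply: fps_order_geM lt_m.
Qed.

Lemma fps_series_mull z u : (forall n, fps_order_ge n (u n)) ->
  z * fps_series u = fps_series (fun n => z * u n).
Proof.
move=> hu; apply: fpsP => m.
transitivity ((z * \sum_(n < m.+1) u n) m); last first.
  by rewrite big_distrr fps_sumE.
rewrite !fpsM; apply: eq_bigr => i _.
by rewrite (@fps_series_trunc u m) ?leq_subr.
Qed.

Lemma fps_series_mulr z u : (forall n, fps_order_ge n (u n)) ->
  fps_series u * z = fps_series (fun n => u n * z).
Proof.
move=> hu; apply: fpsP => m.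
transitivity (((\sum_(n < m.+1) u n) * z) m); last first.
  by rewrite big_distrl fps_sumE.
rewrite !fpsM; apply: eq_bigr => i _.
by rewrite (@fps_series_trunc u m) // -ltnS.
Qed.

Lemma eq_fps_series u v : u =1 v -> fps_series u = fps_series v.
Proof. by move=> uv; apply: fpsP => m; apply: eq_bigr => n _; rewrite uv. Qed.

(** The reversal of the summation index in the Cauchy product exchanges the two factors. *)
Lemma fps_comm x y : (forall i j, GRing.comm (x i) (y j)) -> GRing.comm x y.
Proof.
move=> xy; apply: fpsP => m; rewrite !fpsM (reindex_inj rev_ord_inj) /=.
by apply: eq_bigr => i _; rewrite xy subSS subKn // -ltnS.
Qed.
End FpsOrder.

Section QFactorial.
Variables (K : fieldType) (p : K).
Hypothesis p_nroot1 : forall n, p ^+ n.+1 != 1.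

Lemma qnumD i j : qnum p (i + j) = qnum p i + p ^+ i * qnum p j.
Proof. by rewrite /qnum mulrA -mulrDl exprD; congr (_ / _); ring. Qed.

Lemma qnum0 : qnum p 0 = 0.
Proof. by rewrite /qnum expr0 subrr mul0r. Qed.

Lemma qfactS n : qfact p n.+1 = qnum p n.+1 * qfact p n.
Proof. by rewrite /qfact big_nat_recr // mulrC. Qed.

Lemma qfact0 : qfact p 0 = 1.
Proof. by rewrite /qfact big_geq. Qed.

Lemma qnum_neq0 n : qnum p n.+1 != 0.
Proof.
rewrite mulf_neq0 ?invr_eq0 // subr_eq0 eq_sym //.
by rewrite -[p]expr1.
Qed.

Lemma qfactVS n : qnum p n.+1 * (qfact p n.+1)^-1 = (qfact p n)^-1.
Proof. by rewrite qfactS invfM mulrA mulfV ?mul1r // qnum_neq0. Qed.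
End QFactorial.

Section QBinomial.
Variables (K : fieldType) (B : algType K) (p : K).
Hypothesis p_nroot1 : forall n, p ^+ n.+1 != 1.
Variables (w : B) (a b : nat -> B).
Hypotheses (a0 : a 0%N = 1) (b0 : b 0%N = 1).
Hypothesis w_ab : forall i j,
  w * (a i * b j) = a i.+1 * b j + p ^+ i *: (a i * b j.+1).

Local Notation c n := ((qfact p n)^-1).

(** Instances: [w = x + y], [a i = x ^+ i], [b j = y ^+ j] with [y x = p x y],
    and [w = x Y], [a i = x ^+ i (Y - 1) ... (Y - p ^+ i.-1)], [b j = x ^+ j] *)
Lemma qbinomial n :
  \sum_(i < n.+1) (c i *: a i) * (c (n - i)%N *: b (n - i)%N) = c n *: w ^+ n.
Proof.
elim: n => [|n ih].
  rewrite big_ord1 a0 b0. rewrite qfact0 invr1 !scale1r mulr1. by [].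
(* Multiplication by the nonzero (n+1)_p turns the right side into [w] times the previous case. *)
apply: (scalerI (qnum_neq0 p_nroot1 n)).
rewrite scalerA qfactVS // exprS scalerAr -ih scaler_sumr.
pose G i j := (c i * c j) *: (a i * b j).
have GE i j : (c i *: a i) * (c j *: b j) = G i j.
  by rewrite -scalerAl -scalerAr scalerA.
(* The splitting (n+1)_p = (i)_p + p^i (n+1-i)_p matches the two terms of [w_ab]. The first half
   vanishes at i = 0 and the second at i = n+1, because (0)_p = 0; both are then sums over [n.+1]
   indices. *)
transitivity (\sum_(i < n.+2) (qnum p i *: G i (n.+1 - i)%N
                 + (p ^+ i * qnum p (n.+1 - i)) *: G i (n.+1 - i)%N)).
  apply: eq_bigr => i _; rewrite GE -scalerDl -qnumD subnKC //.
  by rewrite -ltnS.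
rewrite big_split big_ord_recl /= qnum0 scale0r add0r.
rewrite [X in _ + X]big_ord_recr /= subnn qnum0 mulr0 scale0r addr0.
rewrite -big_split mulr_sumr; apply: eq_bigr => i _ /=.
have le_in : (i <= n)%N by rewrite -ltnS.
rewrite GE /bump /= subSS subSn // /G -scalerAr w_ab scalerDr !scalerA.
rewrite -(qfactVS p_nroot1 i) -(qfactVS p_nroot1 (n - i)).
congr (_ *: _ + _ *: _); ring.
Qed.
End QBinomial.

(** * q-exponentials *)

Lemma fps_series_fin (A : nzRingType) (u : nat -> fps A) N :
  (forall n, fps_order_ge n (u n)) -> (forall n, (N <= n)%N -> u n = 0) ->
  fps_series u = \sum_(n < N) u n.
Proof.
move=> hu u0; apply: fpsP => m.
rewrite (@fps_series_trunc _ u (maxn m N)) ?leq_maxl // -!(big_mkord xpredT u).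
rewrite (@big_cat_nat _ _ _ N 0 (maxn m N).+1) //=; last first.
  by rewrite ltnW // ltnS leq_maxr.
have -> : \sum_(N <= n < (maxn m N).+1) u n = 0; last by rewrite addr0.
by rewrite big_nat big1 // => n /andP[/u0].
Qed.

Section QExponential.
Variables (K : fieldType) (A : algType K).
Implicit Types (p : K) (w x y g Y : fps A).

Lemma fps_order_geX x n : x 0%N = 0 -> fps_order_ge n (x ^+ n).
Proof. by move=> x0 m; apply: fps_pow_small. Qed.

Lemma fps_order_geZ k n x : fps_order_ge n x -> fps_order_ge n (k *: x).
Proof. by move=> hx m /hx; rewrite fpsZ => ->; rewrite scaler0. Qed.

Lemma fps_coef0_mull x y : x 0%N = 0 -> (x * y) 0%N = 0.
Proof. by move=> x0; rewrite fpsM big_ord1 x0 mul0r. Qed.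

(** For commuting [x] and [Y] this is x^n (Y - 1)(Y - p)...(Y - p^(n-1)). Each copy of [x] stays
    next to one difference, so that a pole of [x] at q = 1 can be cancelled factor by factor. *)
Definition qpoch p x Y n : fps A := \prod_(k < n) (x * (Y - (p ^+ k)%:A)).

Lemma qpochS p x Y n :
  qpoch p x Y n.+1 = qpoch p x Y n * (x * (Y - (p ^+ n)%:A)).
Proof. exact: big_ord_recr. Qed.

Lemma qpoch_order_ge p x Y n : x 0%N = 0 -> fps_order_ge n (qpoch p x Y n).
Proof.
move=> x0; elim: n => [//|n ih]; rewrite qpochS -addn1.
apply: fps_order_geM ih _ => m; rewrite ltnS leqn0 => /eqP ->.
exact: fps_coef0_mull.
Qed.

Lemma qexp_order_ge p x n : x 0%N = 0 ->
  fps_order_ge n ((qfact p n)^-1 *: x ^+ n).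
Proof. by move=> x0; apply/fps_order_geZ/fps_order_geX. Qed.

(** By induction [g] carries each power of [w] to the same power of [w'], hence the series termwise.
    The case [w = w'] says that [g] commutes with the exponential. *)
Lemma qexp_intertwine p g w w' : w 0%N = 0 -> w' 0%N = 0 ->
  g * w = w' * g -> g * qexp p w = qexp p w' * g.
Proof.
move=> w0 w'0 h.
rewrite fps_series_mull; last by move=> n; apply: qexp_order_ge.
rewrite fps_series_mulr; last by move=> n; apply: qexp_order_ge.
apply: eq_fps_series => n; rewrite -scalerAr -scalerAl; congr (_ *: _).
elim: n => [|n ih]; first by rewrite !expr0 mulr1 mul1r.
by rewrite exprSr mulrA ih -mulrA h mulrA -exprSr.
Qed.

Lemma qexp_0 p : qexp p (0 : fps A) = 1.
Proof.
rewrite /qexp (@fps_series_fin _ _ 1).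
- by rewrite big_ord1 qfact0 invr1 expr0 scale1r.
- by move=> n; apply: qexp_order_ge.
- by case=> // n _; rewrite expr0n scaler0.
Qed.

Section Identities.
Variable p : K.
Hypothesis p_nroot1 : forall n, p ^+ n.+1 != 1.
Local Notation c n := ((qfact p n)^-1).

(** Degree by degree, the Cauchy product of the two exponentials is the q-binomial formula: moving
    [y] past x^i costs p^i. *)
Lemma qexp_add x y : x 0%N = 0 -> y 0%N = 0 -> y * x = p *: (x * y) ->
  qexp p (x + y) = qexp p x * qexp p y.
Proof.
move=> x0 y0 yx.
rewrite fps_seriesM; try by move=> n; apply: qexp_order_ge.
apply: eq_fps_series => n; apply/esym/qbinomial => // i j.
have yxi : y * x ^+ i = p ^+ i *: (x ^+ i * y).
  elim: i => [|i ih]; first by rewrite !expr0 scale1r mulr1 mul1r.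
  rewrite exprS mulrA yx -scalerAl -[x * y * _]mulrA ih.
  by rewrite -scalerAr scalerA mulrA -!exprS.
by rewrite mulrDl !mulrA -exprS yxi -scalerAl -mulrA -exprS.
Qed.

(** The q-binomial formula for [w = x * Y], whose recurrence is the splitting xY = x(Y - p^i) + p^i
    x. It expresses the quotient of the exponentials of [x * Y] and [x] by the products [qpoch]. *)
Lemma qexp_mul x Y : x 0%N = 0 -> x * Y = Y * x ->
  qexp p (x * Y) = fps_series (fun n => c n *: qpoch p x Y n) * qexp p x.
Proof.
move=> x0 xY.
rewrite fps_seriesM; last by move=> n; apply: qexp_order_ge.
  apply: eq_fps_series => n; apply/esym/(qbinomial p_nroot1) => //.
    exact: big_ord0.
  move=> i j; have comm_i : x * Y * qpoch p x Y i = qpoch p x Y i * (x * Y).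
    apply: commr_prod => k _; apply: commrM.
      by rewrite /GRing.comm -mulrA -xY.
    apply: commrB; first by rewrite /GRing.comm mulrA -xY.
    by rewrite /GRing.comm -scalerAr -scalerAl mulr1 mul1r.
  rewrite mulrA comm_i qpochS exprS.
  have {1}-> : x * Y = x * (Y - (p ^+ i)%:A) + p ^+ i *: x.
    by rewrite mulrBr -scalerAr mulr1 subrK.
  by rewrite mulrDr mulrDl -scalerAr -scalerAl -!mulrA.
by move=> n; apply/fps_order_geZ/qpoch_order_ge.
Qed.

(** This is [qexp_mul] at Y = p: the factor Y - p kills [qpoch] from degree 2 on, so only two terms
    survive. *)
Lemma qexp_shift x : x 0%N = 0 ->
  qexp p (p *: x) = (1 - (1 - p) *: x) * qexp p x.
Proof.
move=> x0; have -> : p *: x = x * p%:A by rewrite -scalerAr mulr1.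
rewrite qexp_mul //; last by rewrite -scalerAr -scalerAl mulr1 mul1r.
congr (_ * _); rewrite (@fps_series_fin _ _ 2).
- rewrite big_ord_recl big_ord1 /bump /= !qpochS /qpoch big_ord0 !mul1r qfact0.
  rewrite qfactS qfact0 mulr1 invr1 !scale1r.
  rewrite /qnum expr1 divff ?invr1 ?scale1r ?expr0; last first.
    by rewrite subr_eq0 eq_sym -[p]expr1.
  by rewrite mulrBr -scalerAr mulr1 scalerBl scale1r opprB addrC.
- by move=> n; apply/fps_order_geZ/qpoch_order_ge.
- case=> [|[|n]] // _; suff -> : qpoch p x p%:A n.+2 = 0 by rewrite scaler0.
  elim: n => [|n ih]; last by rewrite qpochS ih mul0r.
  by rewrite qpochS expr1 subrr !mulr0.
Qed.

Lemma qexp_conj g x : x 0%N = 0 -> g * x = p *: (x * g) ->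
  g * qexp p x = (1 - (1 - p) *: x) * qexp p x * g.
Proof.
move=> x0 gx; rewrite (@qexp_intertwine _ _ _ (p *: x)) // ?qexp_shift //.
- by rewrite fpsZ x0 scaler0.
- by rewrite gx scalerAl.
Qed.

Lemma qnumV n : p != 0 -> qnum p^-1 n.+1 = p ^- n * qnum p n.+1.
Proof.
move=> p0; have p1 : 1 - p != 0 by rewrite subr_eq0 eq_sym -[p]expr1.
have pV1 : 1 - p^-1 != 0.
  by rewrite subr_eq0 eq_sym invr_eq1 -[p]expr1.
rewrite /qnum mulrA; apply: (mulIf pV1); rewrite mulfVK // -[RHS]mulrA.
have -> : (1 - p)^-1 * (1 - p^-1) = - p^-1 by field; rewrite p0 p1.
by rewrite exprVn exprS invfM; field; rewrite p0 expf_neq0.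
Qed.

(** This is [qexp_mul] at Y = 0, where the left side is 1. The factors -p^k of [qpoch] supply the
    signs and exactly the powers of p by which the factorials for p and 1/p differ. *)
Lemma qexpVl x : p != 0 -> x 0%N = 0 -> qexp p^-1 (- x) * qexp p x = 1.
Proof.
move=> p0 x0; have := @qexp_mul x 0 x0; rewrite mulr0 mul0r => /(_ erefl).
rewrite qexp_0 => ->; congr (_ * _); apply: eq_fps_series; elim=> [|n ih].
  by rewrite !qfact0 /qpoch big_ord0.
rewrite qpochS exprSr !qfactS (invfM (qnum p^-1 _)) (invfM (qnum p _)).
rewrite -!scalerA !scalerAl ih qnumV // sub0r !mulrN.
rewrite -[x * _]scalerAr mulr1
  -!scalerAl -scalerAr (invfM (p ^- n)) invrK !scalerA.
by congr (- (_ *: _)); ring.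
Qed.
End Identities.

Lemma qexpVr p x : (forall n, p ^+ n.+1 != 1) -> p != 0 -> x 0%N = 0 ->
  qexp p x * qexp p^-1 (- x) = 1.
Proof.
move=> p_nroot1 p0 x0; rewrite -{1}[p]invrK -{1}[x]opprK qexpVl ?invr_eq0 //.
  by move=> n; rewrite exprVn invr_eq1.
by rewrite fpsN x0 oppr0.
Qed.
End QExponential.

(** * Gauge transformations of twists *)

Section FpsRingMap.
Variables (A B : nzRingType) (f : {rmorphism A -> B}).

Lemma fmap_is_zmod_morphism : zmod_morphism (fmap f).
Proof. by move=> x y; apply: fpsP => m /=; rewrite rmorphB. Qed.
Lemma fmap_is_monoid_morphism : monoid_morphism (fmap f).
Proof.
split=> [|x y]; apply: fpsP => m.
  by rewrite [LHS]/= (fun_if f) rmorph1 rmorph0.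
by rewrite /= rmorph_sum; apply: eq_bigr => i _; rewrite rmorphM.
Qed.
HB.instance Definition _ :=
  GRing.isZmodMorphism.Build (fps A) (fps B) (fmap f) fmap_is_zmod_morphism.
HB.instance Definition _ :=
  GRing.isMonoidMorphism.Build (fps A) (fps B) (fmap f)
    fmap_is_monoid_morphism.

Lemma fmapM x y : fmap f (x * y) = fmap f x * fmap f y.
Proof. exact: rmorphM. Qed.
Lemma fmap1 : fmap f 1 = 1.
Proof. exact: rmorph1. Qed.

Lemma fmap_series u :
  fmap f (fps_series u) = fps_series (fun n => fmap f (u n)).
Proof. by apply: fpsP => m /=; rewrite raddf_sum. Qed.

End FpsRingMap.

Section FpsLinearMap.
Variables (K : comNzRingType) (A B : algType K) (f : {lrmorphism A -> B}).

Lemma fmap_is_scalable : scalable (fmap f).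
Proof. by move=> k x; apply: fpsP => m /=; rewrite linearZ. Qed.
HB.instance Definition _ :=
  GRing.isScalable.Build K (fps A) (fps B) *:%R (fmap f) fmap_is_scalable.

Lemma fmap_fpsZC z v : fmap f (fpsZC z v) = fpsZC z (f v).
Proof. by apply: fpsP => m /=; rewrite linearZ. Qed.

End FpsLinearMap.

Lemma fmap_comp T1 T2 T3 (g : T2 -> T3) (f : T1 -> T2) x :
  fmap g (fmap f x) = fmap (g \o f) x.
Proof. by []. Qed.

Lemma eq_fmap T1 T2 (f g : T1 -> T2) : f =1 g -> fmap f =1 fmap g.
Proof. by move=> fg x; apply: fpsP => m /=. Qed.

Lemma fmap_qexp (K : fieldType) (A B : algType K) (f : {lrmorphism A -> B})
  p x : fmap f (qexp p x) = qexp p (fmap f x).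
Proof.
rewrite /qexp fmap_series; apply: eq_fps_series => n.
by rewrite linearZ /= rmorphXn.
Qed.

Section FpsScalar.
Variables (K : comNzRingType) (A : algType K).
Implicit Types (z : fps K) (v : A).

Lemma fpsZCM z z' v v' : fpsZC z v * fpsZC z' v' = fpsZC (z * z') (v * v').
Proof.
apply: fpsP => m; rewrite !fpsM /= scaler_suml; apply: eq_bigr => i _.
by rewrite -scalerAl -scalerAr scalerA.
Qed.
Lemma fpsZC1 : fpsZC 1 (1 : A) = 1.
Proof.
by apply: fpsP => m /=; case: eqP => _; rewrite ?scale1r ?scale0r.
Qed.
Lemma fpsZCr k z v : fpsZC z (k *: v) = k *: fpsZC z v.
Proof. by apply: fpsP => m; rewrite fpsZ /= !scalerA mulrC. Qed.
Lemma fpsZCD z v v' : fpsZC z (v + v') = fpsZC z v + fpsZC z v'.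
Proof. by apply: fpsP => m; rewrite fpsD /= scalerDr. Qed.
Lemma fpsZC0 z : fpsZC z (0 : A) = 0.
Proof. by apply: fpsP => m; rewrite /= scaler0. Qed.
End FpsScalar.

Section TensorInclusions.
Variables (K : comNzRingType) (A B : augAlgType K).

Definition tinl (a : A) : tens A B := a ⊗ 1.
Definition tinr (b : B) : tens A B := 1 ⊗ b.

Lemma tinl_is_linear : linear tinl.
Proof. by move=> k x y; rewrite /tinl pureDl pureZl. Qed.
Lemma tinr_is_linear : linear tinr.
Proof. by move=> k x y; rewrite /tinr pureDr pureZr. Qed.
Lemma tinl_is_monoid_morphism : monoid_morphism tinl.
Proof. by split=> // x y; rewrite /tinl tensM mulr1. Qed.
Lemma tinr_is_monoid_morphism : monoid_morphism tinr.
Proof. by split=> // x y; rewrite /tinr tensM mulr1. Qed.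
HB.instance Definition _ :=
  GRing.isLinear.Build K A (tens A B) *:%R tinl tinl_is_linear.
HB.instance Definition _ :=
  GRing.isLinear.Build K B (tens A B) *:%R tinr tinr_is_linear.
HB.instance Definition _ :=
  GRing.isMonoidMorphism.Build A (tens A B) tinl tinl_is_monoid_morphism.
HB.instance Definition _ :=
  GRing.isMonoidMorphism.Build B (tens A B) tinr tinr_is_monoid_morphism.

Lemma tinlr_comm (x : fps A) (y : fps B) :
  GRing.comm (fmap tinl x) (fmap tinr y).
Proof.
by apply: fps_comm => i j; rewrite /GRing.comm /= !tensM !mulr1 !mul1r.
Qed.

Lemma ftensE (x : fps A) (y : fps B) : ftens x y = fmap tinl x * fmap tinr y.
Proof.
apply: fpsP => m; apply: eq_bigr => i _.
by rewrite /= tensM mulr1 mul1r.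
Qed.
End TensorInclusions.

Arguments tinl {K A B}.
Arguments tinr {K A B}.

Lemma tassoc_comm (K : comNzRingType) (A B C : augAlgType K) (a : A)
  (y : tens B C) : GRing.comm (a ⊗ 1 ⊗ 1) (tassoc (1 ⊗ y)).
Proof.
rewrite /GRing.comm; elim/tens_ind: y => [|b c|u v hu hv].
- by rewrite pure0r raddf0 mulr0 mul0r.
- by rewrite tassocE !tensM !mul1r !mulr1.
- by rewrite pureDr raddfD mulrDr mulrDl hu hv.
Qed.

(** Both sides reduce to a1 a2 a3 P Q w. In the application [a1], [a2], [a3] are V in the three
    legs, [d] and [g] are Δ(V) in legs 12 and 23 with inverses [d'] and [g'], and [w] is the
    iterated coproduct of V^-1. *)
Lemma gauge_cocycle (B : pzRingType) (a1 a2 a3 P Q P' Q' d d' g g' w : B) :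
  d' * d = 1 -> g' * g = 1 -> P * Q = P' * Q' ->
  GRing.comm P a3 -> GRing.comm a1 a2 -> GRing.comm a1 a3 -> GRing.comm a1 P' ->
  GRing.comm a1 g ->
  (a1 * a2 * P * d') * (d * a3 * Q * w)
  = (a2 * a3 * P' * g') * (a1 * g * Q' * w).
Proof.
move=> dd gg PQ cP c2 c3 cP' cg.
rewrite -!mulrA (mulrA d') dd mul1r (mulrA P) cP -!mulrA (mulrA P) PQ.
by rewrite (mulrA a1 g) cg -!mulrA (mulrA g') gg mul1r !mulrA c2
  -(mulrA a2 a1) c3 mulrA -(mulrA _ a1 P') cP' !mulrA.
Qed.

Section Gauge.
Variables (K : comNzRingType) (H : bialgType K).
Implicit Types (F : fps (tens H H)) (V : fps H).

Lemma gauge_twist F V : V 0%N = 1 -> fmap counit V = 1 -> is_twist F ->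
  is_twist (ftens V V * F * fmap comul (fpsV V)).
Proof.
move=> V0 epsV [cocycle epsl epsr]; rewrite ftensE.
have VV : fpsV V * V = 1 by exact: fpsVM.
set W := fpsV V.
(* As ε(V) = 1, the copy of V in the leg hit by the counit disappears; the other copy will cancel
   against V^-1. *)
have counitlV : fmap (counitl \o tinl) V = 1.
  rewrite -(fpsZC1 H) -epsV; apply: fpsP => m /=; exact: counitlE.
have counitrV : fmap (counitr \o tinr) V = 1.
  rewrite -(fpsZC1 H) -epsV; apply: fpsP => m /=; exact: counitrE.
have counitlrE (a : H) : (counitl \o tinr) a = a.
  by rewrite /= [LHS]counitlE rmorph1 scale1r.
have counitrlE (a : H) : (counitr \o tinl) a = a.
  by rewrite /= [LHS]counitrE rmorph1 scale1r.
set F' := _ * _ * _ * _.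
split.
(* The four algebra maps of the cocycle equation: [T] and [G] embed in legs 12 and 23, while [D12]
   and [D23] apply Δ to the first and to the second leg. *)
- pose T3 : algType K := tens (tens H H) H.
  pose T : {lrmorphism tens H H -> T3} := tinl.
  pose D12 : {lrmorphism tens H H -> T3} := tmap comul idfun.
  pose G : {lrmorphism tens H H -> T3} := tassoc \o tinr.
  pose D23 : {lrmorphism tens H H -> T3} := tassoc \o tmap idfun comul.
  change (fmap T F' * fmap D12 F' = fmap G F' * fmap D23 F').
  change (fmap T F * fmap D12 F = fmap G F * fmap D23 F) in cocycle.
  pose a3 : fps T3 := fmap tinr V.
  have D12l : fmap D12 (fmap tinl V) = fmap T (fmap comul V).
    by apply: fpsP => m /=; rewrite [LHS]tmapE.
  have D12r : fmap D12 (fmap tinr V) = a3.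
    by apply: fpsP => m /=; rewrite [LHS]tmapE rmorph1.
  have Gl : fmap G (fmap tinl V) = fmap T (fmap tinr V).
    by apply: fpsP => m /=; rewrite [LHS]tassocE.
  have Gr : fmap G (fmap tinr V) = a3.
    by apply: fpsP => m /=; rewrite [LHS]tassocE.
  have D23l : fmap D23 (fmap tinl V) = fmap T (fmap tinl V).
    by apply: fpsP => m /=; rewrite tmapE rmorph1 [LHS]tassocE.
  have D23r : fmap D23 (fmap tinr V) = fmap G (fmap comul V).
    by apply: fpsP => m /=; rewrite tmapE.
  (* Coassociativity makes the last factors of the two sides agree. *)
  have D2 : fmap D12 (fmap comul W) = fmap D23 (fmap comul W).
    apply: (@eq_fmap _ _ (D12 \o comul) (D23 \o comul)) => x.
    by rewrite /= -comulA.
  have GC x : GRing.comm (fmap T (fmap tinl V)) (fmap G x).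
    by apply: fps_comm => i j; apply: tassoc_comm.
  have TC x : GRing.comm (fmap T x) a3 by exact: tinlr_comm.
  have DWV : fmap comul W * fmap comul V = 1 by rewrite -fmapM VV fmap1.
  have invW (g : {lrmorphism tens H H -> T3}) :
      fmap g (fmap comul W) * fmap g (fmap comul V) = 1.
    by rewrite -fmapM DWV fmap1.
  rewrite /F'; move: (fmap comul W) (fmap comul V) (fmap tinl V) (fmap tinr V)
    DWV D12l D12r Gl Gr D23l D23r D2 GC invW => dW dV lV rV.
  clearbody T D12 G D23 a3 => DWV D12l D12r Gl Gr D23l D23r D2 GC invW.
  rewrite !fmapM D12l D12r D23l D23r D2 Gl Gr; apply: gauge_cocycle => //.
  - exact: invW.
  - exact: invW.
  - by rewrite -Gl; apply: GC.
- rewrite /F' !fmapM epsl mulr1 fmap_comp counitlV mul1r.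
  rewrite fmap_comp (eq_fmap counitlrE).
  by rewrite fmap_comp (eq_fmap (@comul_counitl _ H)) fpsMV.
- rewrite /F' !fmapM epsr mulr1 [X in _ * X * _]fmap_comp counitrV mulr1.
  rewrite fmap_comp (eq_fmap counitrlE).
  by rewrite fmap_comp (eq_fmap (@comul_counitr _ H)) fpsMV.
Qed.
End Gauge.

(** * The twist of a pair of skew-primitive elements *)

Lemma qexp_comm (K : fieldType) (A : algType K) p r (x y : fps A) :
  x 0%N = 0 -> y 0%N = 0 -> x * y = y * x ->
  qexp p x * qexp r y = qexp r y * qexp p x.
Proof. by move=> x0 y0 xy; do 2!apply/esym/qexp_intertwine => //. Qed.

Section SkewPrimitiveTwist.
Variables (K : fieldType) (H : bialgType K) (p : K).
Hypothesis p_nroot1 : forall n, p ^+ n.+1 != 1.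
Variables (e f h : H) (z : fps K).
Hypotheses (comul_e : comul e = h ⊗ e + e ⊗ 1)
  (comul_f : comul f = f ⊗ h + 1 ⊗ f).
Hypotheses (counit_e : counit e = 0) (counit_f : counit f = 0).
Hypotheses (he : h * e = p *: (e * h)) (hf : h * f = p *: (f * h)).
Hypotheses (ef : e * f = f * e) (z0 : z 0%N = 0).

(** With [a], [b], [c] as in the proof, Δ ⊗ id sends f ⊗ e to c + b and id ⊗ Δ sends it to a + b.
    The addition formula gives exp(a) exp(c) exp(b) and exp(c) exp(a) exp(b), which agree because
    [a] and [c] commute. *)
Lemma skew_primitive_twist : is_twist (qexp p (fpsZC z (f ⊗ e))).
Proof.
have Z0 (A : algType K) (v : A) : fpsZC z v 0%N = 0 by rewrite /= z0 scale0r.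
set F := qexp _ _; split.
- pose T3 : algType K := tens (tens H H) H.
  pose T : {lrmorphism tens H H -> T3} := tinl.
  pose D12 : {lrmorphism tens H H -> T3} := tmap comul idfun.
  pose G : {lrmorphism tens H H -> T3} := tassoc \o tinr.
  pose D23 : {lrmorphism tens H H -> T3} := tassoc \o tmap idfun comul.
  change (fmap T F * fmap D12 F = fmap G F * fmap D23 F).
  rewrite /F !fmap_qexp !fmap_fpsZC.
  pose a : T3 := f ⊗ e ⊗ 1.
  pose b : T3 := f ⊗ h ⊗ e.
  pose c : T3 := 1 ⊗ f ⊗ e.
  have -> : T (f ⊗ e) = a by [].
  have -> : D12 (f ⊗ e) = c + b.
    by rewrite /= tmapE /= comul_f pureDl addrC.
  have -> : G (f ⊗ e) = c by rewrite /= [LHS]tassocE.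
  have -> : D23 (f ⊗ e) = a + b.
    by rewrite /= tmapE /= comul_e pureDr raddfD /= !tassocE addrC.
  have ba : b * a = p *: (a * b).
    by rewrite /a /b !tensM he pureZr pureZl mulr1 mul1r.
  have bc : b * c = p *: (c * b).
    by rewrite /b /c !tensM hf pureZr pureZl mulr1 mul1r.
  have ac : a * c = c * a by rewrite /a /c !tensM ef !mulr1 !mul1r.
  have skew (u v : T3) : v * u = p *: (u * v) ->
      qexp p (fpsZC z (u + v)) = qexp p (fpsZC z u) * qexp p (fpsZC z v).
    by move=> vu; rewrite fpsZCD qexp_add ?Z0 // !fpsZCM vu fpsZCr.
  rewrite (skew c b bc) (skew a b ba).
  clearbody a b c.
  have aa : fpsZC z a * fpsZC z c = fpsZC z c * fpsZC z a.
    by rewrite !fpsZCM ac.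
  have := qexp_comm p p (Z0 _ a) (Z0 _ c) aa.
  move: (qexp p _) (qexp p _) (qexp p _) => u v w uv.
  rewrite mulrA.
  rewrite uv.
  by rewrite -mulrA.
- rewrite /F fmap_qexp fmap_fpsZC [X in fpsZC _ X]counitlE counit_f.
  rewrite scale0r fpsZC0.
  exact: qexp_0.
- rewrite /F fmap_qexp fmap_fpsZC [X in fpsZC _ X]counitrE counit_e.
  rewrite scale0r fpsZC0.
  exact: qexp_0.
Qed.
End SkewPrimitiveTwist.

(** * Factorization of the gauged twist into two [qpoch] series *)

Section Factorization.
Variables (K : fieldType) (A : algType K) (p : K).
Hypothesis p_nroot1 : forall n, p ^+ n.+1 != 1.
Hypothesis p0 : p != 0.
Variables (x1 x2 y1 y2 h h' : fps A).
Hypotheses (x10 : x1 0%N = 0) (x20 : x2 0%N = 0).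
Hypotheses (y10 : y1 0%N = 0) (y20 : y2 0%N = 0).
Hypotheses (y1x1 : y1 * x1 = p *: (x1 * y1)) (hx2 : h * x2 = p *: (x2 * h)).
Hypotheses (x1h : x1 * h = h * x1) (y1h : y1 * h = h * y1).
Hypotheses (x1h' : x1 * h' = h' * x1).
Hypotheses (y1x2 : y1 * x2 = x2 * y1) (y1y2 : y1 * y2 = y2 * y1).
Hypotheses (x2hy2 : (x2 * h) * y2 = y2 * (x2 * h)).
Local Notation P := (qexp p).
Local Notation R := (qexp p^-1).
Local Notation d := (fpsV (1 + (1 - p) *: x1)).

(** [x1], [x2], [y1], [y2], [h], [h'] stand for [x (x) 1], [1 (x) x], [y (x) 1],
    [1 (x) y], [1 (x) h], [1 (x) h^-1], and [- (1 - p) *: (y1 * (x2 * h))] is the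
    exponent of the middle factor of F_CG. *)
Lemma factorization :
  (P (- x1) * R y1) * (P (- x2) * R y2) * P (- (1 - p) *: (y1 * (x2 * h)))
    * (P (- y2) * P (- (y1 * h)) * (R x2 * R (x1 * h')))
  = fps_series (fun n => (qfact p n)^-1 *: qpoch p (- (d * y1)) h n)
    * fps_series (fun n => (qfact p^-1 n)^-1 *: qpoch p^-1 x1 h' n).
Proof.
have pV_nroot1 n : p^-1 ^+ n.+1 != 1 by rewrite exprVn invr_eq1.
have N0 (x : fps A) : x 0%N = 0 -> (- x) 0%N = 0.
  by move=> hx; rewrite fpsN hx oppr0.
have PR (x : fps A) : x 0%N = 0 -> P (- x) * R x = 1.
  by move=> hx; have := qexpVr p_nroot1 p0 (N0 x hx); rewrite opprK.
have RP (x : fps A) : x 0%N = 0 -> R x * P (- x) = 1.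
  move=> hx; have := qexpVl p_nroot1 p0 (N0 x hx); rewrite opprK; exact.
have M0 := @fps_coef0_mull K A.
set c := _ *: (y1 * _).
have c0 : c 0%N = 0 by rewrite fpsZ M0 // scaler0.
(* The exponent [c] commutes with [y2], so [R y2] passes through and meets its inverse. *)
have step1 : R y2 * (P c * P (- y2)) = P c.
  have y2c : y2 * c = c * y2.
    by rewrite -scalerAr -scalerAl (mulrA y2 y1) -y1y2 -mulrA -x2hy2 !mulrA.
  by rewrite mulrA (qexp_comm _ _ y20 c0 y2c) -mulrA RP // mulr1.
(* The two exponentials merge into one with exponent - y1 (1 + (1-p) x2) h. Moving [P (- x2)] across
   [h] absorbs the middle factor and leaves - y1 h. *)
have step2 : P (- x2) * (P c * P (- (y1 * h))) = P (- (y1 * h)) * P (- x2).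
  have yh0 : (- (y1 * h)) 0%N = 0 by exact/N0/M0.
  have yc : - (y1 * h) * c = p *: (c * - (y1 * h)).
    rewrite mulrN mulNr scalerN; congr (- _).
    rewrite /c -scalerAr -scalerAl scalerA mulrC -scalerA; congr (_ *: _).
    have hyh : h * (y1 * h) = y1 * (h * h) by rewrite mulrA -y1h -mulrA.
    have hyx : h * (y1 * (x2 * h)) = p *: (y1 * (x2 * (h * h))).
      by rewrite mulrA -y1h -mulrA (mulrA h x2) hx2 -scalerAl -scalerAr -!mulrA.
    by rewrite -!mulrA hyx hyh -scalerAr (mulrA x2 y1) -y1x2 -mulrA.
  rewrite -(qexp_add p_nroot1 c0 yh0 yc).
  have cyh0 : (c - y1 * h) 0%N = 0 by rewrite fpsD c0 yh0 addr0.
  apply: (qexp_intertwine _ cyh0 yh0).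
  set k := 1 - (1 - p) *: (- x2).
  have -> : c - y1 * h = - (y1 * (k * h)).
    rewrite /k scalerN opprK mulrDl mul1r -scalerAl mulrDr opprD addrC.
    by rewrite -scalerAr /c scaleNr.
  have hx2N : h * - x2 = p *: (- x2 * h) by rewrite mulrN hx2 mulNr scalerN.
  have hP := qexp_conj p_nroot1 (N0 _ x20) hx2N; rewrite -/k in hP.
  have commP (g : fps A) (gx : g * x2 = x2 * g) : P (- x2) * g = g * P (- x2).
    have gxN : g * - x2 = - x2 * g by rewrite mulrN mulNr gx.
    by rewrite (qexp_intertwine _ (N0 _ x20) (N0 _ x20) gxN).
  have kP : P (- x2) * k = k * P (- x2).
    apply: commP; rewrite /k mulrBr mulrBl mulr1 mul1r; congr (_ - _).
    by rewrite -scalerAr -scalerAl mulrN mulNr.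
  rewrite mulrN mulNr -(mulrA y1 h) hP !mulrA (commP _ y1x2).
  by rewrite -(mulrA y1 _ k) kP !mulrA.
set D := d.
have l0 : ((1 - p) *: x1) 0%N = 0 by rewrite fpsZ x10 scaler0.
have k0 : (1 + (1 - p) *: x1) 0%N = 1 by rewrite fpsD l0 addr0.
have dK : D * (1 + (1 - p) *: x1) = 1 by exact: fpsVM.
have Kd : (1 + (1 - p) *: x1) * D = 1 by exact: fpsMV.
have hK : h * (1 + (1 - p) *: x1) = (1 + (1 - p) *: x1) * h.
  by rewrite mulrDr mulrDl mulr1 mul1r -scalerAr -scalerAl x1h.
have hd : h * D = D * h.
  by rewrite -[LHS]mul1r -dK -mulrA (mulrA _ h) -hK -mulrA Kd mulr1.
(* By [qexp_conj], moving [y1] to the right of [P (- x1)] produces the factor 1 + (1-p) x1, whose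
   inverse is [D]. *)
have yP : P (- x1) * y1 = D * y1 * P (- x1).
  have -> : P (- x1) * y1 = D * ((1 + (1 - p) *: x1) * P (- x1) * y1).
    by rewrite !mulrA dK mul1r.
  rewrite -[RHS]mulrA; congr (_ * _).
  have y1x1N : y1 * - x1 = p *: (- x1 * y1) by rewrite mulrN mulNr y1x1 scalerN.
  by rewrite (qexp_conj p_nroot1 (N0 _ x10) y1x1N) scalerN opprK.
have hP : P (- x1) * h = h * P (- x1).
  have hx1N : h * - x1 = - x1 * h by rewrite mulrN mulNr x1h.
  by rewrite (qexp_intertwine _ (N0 _ x10) (N0 _ x10) hx1N).
have Dy0 : (D * y1) 0%N = 0 by rewrite fpsM big_ord1 y10 mulr0.
have Dyh0 : (- (D * y1) * h) 0%N = 0 by exact/M0/N0.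
have step3 : P (- x1) * (R y1 * P (- (y1 * h)))
    = R (D * y1) * P (- (D * y1) * h) * P (- x1).
  rewrite mulrA (qexp_intertwine _ y10 Dy0 yP) -[LHS]mulrA -[RHS]mulrA.
  congr (_ * _); apply: (qexp_intertwine _ (N0 _ (M0 _ _ y10)) Dyh0).
  by rewrite mulrN mulrA yP -(mulrA (D * y1)) hP !mulNr !mulrA.
have Dyh : D * y1 * h = h * (D * y1) by rewrite mulrA hd -!mulrA y1h.
have step4 : R (D * y1) * P (- (D * y1) * h)
    = fps_series (fun n => (qfact p n)^-1 *: qpoch p (- (D * y1)) h n).
  have DyhC : D * y1 * (- (D * y1) * h) = - (D * y1) * h * (D * y1).
    by rewrite !mulNr mulrN -(mulrA (D * y1) h) -Dyh.
  rewrite (qexp_comm _ _ Dy0 Dyh0 DyhC).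
  rewrite (qexp_mul p_nroot1 (N0 _ Dy0)); last by rewrite mulNr mulrN Dyh.
  by rewrite -mulrA PR // mulr1.
have step5 : P (- x1) * R (x1 * h')
    = fps_series (fun n => (qfact p^-1 n)^-1 *: qpoch p^-1 x1 h' n).
  have xxh : - x1 * (x1 * h') = x1 * h' * - x1.
    by rewrite mulNr mulrN -mulrA -x1h'.
  rewrite (qexp_comm _ _ (N0 _ x10) (M0 _ h' x10) xxh).
  by rewrite (qexp_mul pV_nroot1 x10 x1h') -mulrA RP // mulr1.
rewrite -step4 -step5; move: step1 step2 step3 (PR _ x20).
move: (P (- x1)) (R y1) (P (- x2)) (R y2) (P c) (P (- y2)) (P (- (y1 * h)))
  (R x2) (R (x1 * h')) (R (D * y1) * P (- (D * y1) * h)).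
move=> b1 b2 b3 b4 b5 b6 b7 b8 b9 b10 s1 s2 s3 s4.
(* From the inside out: [step1] removes the exponentials of [y2], [step2] the middle factor, then
   [P (- x2)] meets its inverse [R x2], and [step3] applies. *)
transitivity (b1 * (b2 * (b3 * ((b4 * (b5 * b6)) * b7) * b8)) * b9).
  by rewrite !mulrA.
by rewrite s1 s2 -(mulrA b7) s4 mulr1 s3 -mulrA.
Qed.
End Factorization.

Lemma fmap_counit_qexp (K : fieldType) (H : augAlgType K) p (x : fps H) :
  fmap counit x = 0 -> fmap counit (qexp p x) = 1.
Proof.
move=> x0; apply: fpsP => m.
transitivity (\sum_(n < m.+1) counit (((qfact p n)^-1 *: x ^+ n) m)).
  exact: raddf_sum.
have xn n : counit ((x ^+ n) m) = (0 ^+ n : fps K) m.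
  by rewrite -x0 -rmorphXn.
have cZ k (v : H) : counit (k *: v) = k * counit v by exact: linearZ.
rewrite big_ord_recl big1 => [|n _]; rewrite fpsZ cZ xn.
  by rewrite qfact0 invr1 mul1r expr0 addr0.
by rewrite expr0n fps0 mulr0.
Qed.

Lemma fmap_qexpN_qexp (K : fieldType) (A B : algType K)
  (phi : {lrmorphism A -> B}) p r x y :
  fmap phi (qexp p (- x) * qexp r y)
  = qexp p (- fmap phi x) * qexp r (fmap phi y).
Proof. by rewrite fmapM !fmap_qexp raddfN. Qed.

(** * The gauged twist of a skew-primitive pair *)

Section GaugedTwist.
Variables (K : fieldType) (H : bialgType K) (p k : K).
Hypothesis p_nroot1 : forall n, p ^+ n.+1 != 1.
Hypotheses (p0 : p != 0) (kp : (1 - p) * k = - p).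
Variables (e f h h' : H) (zeta : fps K).
Hypotheses (comul_e : comul e = h ⊗ e + e ⊗ 1)
  (comul_f : comul f = f ⊗ h + 1 ⊗ f) (comul_h' : comul h' = h' ⊗ h').
Hypotheses (counit_e : counit e = 0) (counit_f : counit f = 0).
Hypotheses (he : h * e = p *: (e * h)) (hf : h * f = p *: (f * h)).
Hypotheses (ef : e * f = f * e) (hh' : h * h' = 1) (h'h : h' * h = 1).
Hypothesis zeta0 : zeta 0%N = 0.

Local Notation E := (e * h').

Let Eh : E * h = e. Proof. by rewrite -mulrA h'h mulr1. Qed.
Let hE : h * E = p *: (E * h).
Proof. by rewrite Eh mulrA he -scalerAl -mulrA hh' mulr1. Qed.
Let fh' : f * h' = p *: (h' * f).
Proof.
have -> : f * h' = h' * (h * f) * h' by rewrite mulrA h'h mul1r.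
by rewrite hf -scalerAr -scalerAl -!mulrA hh' mulr1.
Qed.
Let fE : f * E = p *: (E * f).
Proof. by rewrite mulrA -ef -mulrA fh' -scalerAr mulrA. Qed.
Let h'E : h' * E = p^-1 *: (E * h').
Proof.
have -> : E * h' = h' * (h * E) * h' by rewrite mulrA h'h mul1r.
by rewrite hE -scalerAr -scalerAl scalerA mulVf // scale1r -!mulrA hh' mulr1.
Qed.
Let comul_E : comul E = 1 ⊗ E + E ⊗ h'.
Proof. by rewrite rmorphM /= comul_h' comul_e mulrDl !tensM hh' mul1r. Qed.

Local Notation il := (@tinl K H H).
Local Notation ir := (@tinr K H H).
Local Notation X := (fpsZC zeta (k *: E)).
Local Notation Y := (fpsZC fpsT (k *: f)).
Local Notation x1 := (fpsZC zeta (k *: il E)).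
Local Notation x2 := (fpsZC zeta (k *: ir E)).
Local Notation y1 := (fpsZC fpsT (k *: il f)).
Local Notation y2 := (fpsZC fpsT (k *: ir f)).
Local Notation g := (fpsZC 1 (ir h)).
Local Notation g' := (fpsZC 1 (ir h')).
Local Notation P := (qexp p).
Local Notation R := (qexp p^-1).

Let Z0 (A : algType K) (v : A) : fpsZC zeta v 0%N = 0.
Proof. by rewrite /= zeta0 scale0r. Qed.
Let T0 (A : algType K) (v : A) : fpsZC fpsT v 0%N = 0.
Proof. by rewrite /= scale0r. Qed.
Let N0 (A : algType K) (x : fps A) : x 0%N = 0 -> (- x) 0%N = 0.
Proof. by move=> hx; rewrite fpsN hx oppr0. Qed.
Let pV_nroot1 n : p^-1 ^+ n.+1 != 1.
Proof. by rewrite exprVn invr_eq1. Qed.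

Definition gaugeV : fps H := P (- X) * R Y.
Definition gaugedF : fps (tens H H) :=
  ftens gaugeV gaugeV * P (fpsZC (zeta * fpsT) ((p * k) *: (f ⊗ e)))
  * fmap comul (fpsV gaugeV).

Lemma gaugeV0 : gaugeV 0%N = 1.
Proof. exact: fpsM_coef0 (qexp0 _ _) (qexp0 _ _). Qed.

(** The inverse is unique. This explicit form lets the coproduct of V^-1 be expanded by the addition
    formula. *)
Lemma gaugeV_inv : fpsV gaugeV = P (- Y) * R X.
Proof.
have XV : P (- X) * R X = 1.
  by have := qexpVr p_nroot1 p0 (N0 (Z0 (k *: E))); rewrite opprK.
have YV : R Y * P (- Y) = 1.
  by have := qexpVl p_nroot1 p0 (N0 (T0 (k *: f))); rewrite opprK; apply.
have VW : gaugeV * (P (- Y) * R X) = 1.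
  rewrite /gaugeV; move: XV YV; move: (P (- X)) (R X) (P (- Y)) (R Y).
  by move=> a b c d ab dc; rewrite -mulrA (mulrA d) dc mul1r.
by rewrite -[LHS]mulr1 -VW mulrA fpsVM ?gaugeV0 // mul1r.
Qed.

Lemma gaugedF_twist : is_twist gaugedF.
Proof.
apply: gauge_twist; first exact: gaugeV0.
  rewrite /gaugeV fmapM !fmap_counit_qexp ?mulr1 //.
    by apply: fpsP => m /=; rewrite !linearZ /= counit_f !mulr0.
  apply: fpsP => m /=; rewrite linearN !linearZ rmorphM /= counit_e.
  by rewrite mul0r !mulr0 oppr0.
(* The scalar p k is absorbed into [f], whose multiples satisfy the same relations. *)
rewrite -pureZl; apply: (skew_primitive_twist p_nroot1 comul_e) => //.
- by rewrite linearZ /= comul_f scalerDr pureZl pureZr.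
- by rewrite linearZ /= counit_f mulr0.
- by rewrite -scalerAr -scalerAl hf scalerA mulrC -scalerA.
- by rewrite -scalerAr -scalerAl ef.
- by rewrite fpsM big_ord1 zeta0 mul0r.
Qed.

Lemma gaugedFE : gaugedF
  = fps_series (fun n => (qfact p n)^-1 *:
       qpoch p (- (fpsV (1 + (1 - p) *: x1) * y1)) g n)
    * fps_series (fun n => (qfact p^-1 n)^-1 *: qpoch p^-1 x1 g' n).
Proof.
have zT : zeta * fpsT = fpsT * zeta by apply: fps_comm => i j; apply: mulrC.
have one (z : fps K) : z * 1 = z by apply: mulr1.
have one' (z : fps K) : 1 * z = z by apply: mul1r.
have lr (v w : H) : il v * ir w = ir w * il v.
  by rewrite !tensM !mulr1 !mul1r.
have ilZ a v : il (a *: v) = a *: il v by exact: linearZ.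
have irZ a v : ir (a *: v) = a *: ir v by exact: linearZ.
have ilM v w : il v * il w = il (v * w) by rewrite -rmorphM.
have irM v w : ir v * ir w = ir (v * w) by rewrite -rmorphM.
have ilr (v w : H) : il v * ir w = v ⊗ w by rewrite tensM mulr1 mul1r.
have y1x1 : y1 * x1 = p *: (x1 * y1).
  rewrite !fpsZCM zT -!scalerAl -!scalerAr !ilM fE ilZ -!fpsZCr.
  by rewrite !scalerA; congr (fpsZC _ (_ *: _)); ring.
have gx2 : g * x2 = p *: (x2 * g).
  rewrite !fpsZCM one one' -!scalerAl -!scalerAr !irM hE irZ -!fpsZCr.
  by rewrite !scalerA; congr (fpsZC _ (_ *: _)); ring.
have x1g : x1 * g = g * x1.
  by rewrite !fpsZCM one one' -!scalerAl -!scalerAr lr.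
have y1g : y1 * g = g * y1.
  by rewrite !fpsZCM one one' -!scalerAl -!scalerAr lr.
have x1g' : x1 * g' = g' * x1.
  by rewrite !fpsZCM one one' -!scalerAl -!scalerAr lr.
have y1x2 : y1 * x2 = x2 * y1.
  by rewrite !fpsZCM zT -!scalerAl -!scalerAr lr.
have y1y2 : y1 * y2 = y2 * y1.
  by rewrite !fpsZCM -!scalerAl -!scalerAr lr.
have x2gy2 : x2 * g * y2 = y2 * (x2 * g).
  by rewrite !fpsZCM one zT -!scalerAl -!scalerAr !irM Eh ef.
rewrite -(factorization p_nroot1 p0 (Z0 _) (Z0 _) (T0 _) (T0 _) y1x1 gx2
  x1g y1g x1g' y1x2 y1y2 x2gy2).
have ilC z v : fmap il (fpsZC z (k *: v)) = fpsZC z (k *: il v).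
  by rewrite -ilZ; apply: fmap_fpsZC.
have irC z v : fmap ir (fpsZC z (k *: v)) = fpsZC z (k *: ir v).
  by rewrite -irZ; apply: fmap_fpsZC.
have VE : fmap il gaugeV = P (- x1) * R y1.
  by have := fmap_qexpN_qexp il p p^-1 X Y; rewrite (ilC zeta) (ilC fpsT).
have VE' : fmap ir gaugeV = P (- x2) * R y2.
  by have := fmap_qexpN_qexp ir p p^-1 X Y; rewrite (irC zeta) (irC fpsT).
(* The product y1 x2 h carries k^2, and [kp] turns -(1-p) k^2 into p k. *)
have CE : fpsZC (zeta * fpsT) ((p * k) *: (f ⊗ e))
    = - (1 - p) *: (y1 * (x2 * g)).
  rewrite !fpsZCM one zT -!scalerAl -!scalerAr !irM Eh tensM mulr1 mul1r.
  rewrite -!fpsZCr !scalerA; congr (fpsZC _ (_ *: _)).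
  by rewrite mulNr kp opprK.
have comulC z v : fmap comul (fpsZC z (k *: v)) = fpsZC z (k *: comul v).
  have -> : k *: comul v = comul (k *: v) by rewrite linearZ.
  exact: fmap_fpsZC.
have YE : fmap comul Y = y2 + y1 * g.
  by rewrite comulC fpsZCM one -scalerAl ilr comul_f addrC scalerDr fpsZCD.
have XE : fmap comul X = x2 + x1 * g'.
  by rewrite comulC fpsZCM one -scalerAl ilr comul_E scalerDr fpsZCD.
have gy2 : g * y2 = p *: (y2 * g).
  rewrite !fpsZCM one one' -!scalerAl -!scalerAr !irM hf irZ -!fpsZCr.
  by rewrite !scalerA mulrC.
have g'x2 : g' * x2 = p^-1 *: (x2 * g').
  rewrite !fpsZCM one one' -!scalerAl -!scalerAr !irM h'E irZ -!fpsZCr.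
  by rewrite !scalerA mulrC.
have x1x2 : x1 * x2 = x2 * x1.
  by rewrite !fpsZCM -!scalerAl -!scalerAr lr.
have yg0 : (y1 * g) 0%N = 0 by exact: fps_coef0_mull (T0 _).
have xg0 : (x1 * g') 0%N = 0 by exact: fps_coef0_mull (Z0 _).
have y2yg : - (y1 * g) * - y2 = p *: (- y2 * - (y1 * g)).
  by rewrite !mulrNN -mulrA gy2 -scalerAr !mulrA y1y2.
have x2xg : x1 * g' * x2 = p^-1 *: (x2 * (x1 * g')).
  by rewrite -mulrA g'x2 -scalerAr !mulrA x1x2.
(* Both Δ(Y) and Δ(X) are sums of two q-commuting terms, with parameter p for the first and 1/p for
   the second. *)
have DE : fmap comul (P (- Y) * R X)
    = P (- y2) * P (- (y1 * g)) * (R x2 * R (x1 * g')).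
  rewrite fmap_qexpN_qexp YE XE opprD.
  by rewrite (qexp_add p_nroot1 (N0 (T0 _)) (N0 yg0) y2yg)
    (qexp_add pV_nroot1 (Z0 _) xg0 x2xg).
rewrite /gaugedF ftensE gaugeV_inv DE CE VE VE'.
by [].
Qed.
End GaugedTwist.

(** * The case of U'_q(sl_3) *)

Lemma FCGE (K : fieldType) (qs : {x : K | x != 0}) (zeta : fps K) :
  FCG qs zeta = gaugedF (val qs ^- 2) (1 - val qs ^+ 2)^-1
    (ugen (Ee n1) : Uq (val qs)) (ugen (Ff n2))
    (ugen (LL n1) ^+ 2 * ugen (LV n2) ^+ 2) zeta.
Proof. by rewrite /gaugedF /gaugeV invrK mulrA. Qed.

Section CartanElements.
Variables (K : fieldType) (qs : {x : K | x != 0}).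
Local Notation q := (val qs).
Local Notation U := (Uq q).
Local Notation L i := (ugen (LL i) : U).
Local Notation L' i := (ugen (LV i) : U).
Local Notation e := (ugen (Ee n1) : U).
Local Notation f := (ugen (Ff n2) : U).
Local Notation h := (L' n1 ^+ 2 * L n2 ^+ 2).
Local Notation h' := (L n1 ^+ 2 * L' n2 ^+ 2).
Let q0 : q != 0 := valP qs.
Let r := @Uq_relP K q.

Lemma comm_prod_inv (A : nzRingType) (a b a' b' : A) :
  a * a' = 1 -> b * b' = 1 -> GRing.comm b a' ->
  (a * b) * (a' * b') = 1.
Proof.
by move=> aa bb ba; rewrite -mulrA (mulrA b) ba -(mulrA a') bb mulr1.
Qed.

Lemma mulXV2 (A : nzRingType) (a b : A) : a * b = 1 -> a ^+ 2 * b ^+ 2 = 1.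
Proof. by move=> ab; rewrite !expr2 -mulrA (mulrA a b) ab mul1r. Qed.

Lemma Uq_hh' : h * h' = 1.
Proof.
apply: comm_prod_inv; [exact/mulXV2/(Uq_LVL r)|exact/mulXV2/(Uq_LLV r)|].
by apply/commrX/commr_sym/commrX; have := qcLL q n1 n2; rewrite /qc scale1r.
Qed.
Lemma Uq_h'h : h' * h = 1.
Proof.
apply: comm_prod_inv; [exact/mulXV2/(Uq_LLV r)|exact/mulXV2/(Uq_LVL r)|].
by apply/commrX/commr_sym/commrX; have := qcVV q n1 n2; rewrite /qc scale1r.
Qed.
Lemma Uq_he : h * e = q ^- 2 *: (e * h).
Proof.
have := qcM (qcX 2 (qcVe q0 n1 n1)) (qcX 2 (qcLe q n2 n1)).
by rewrite /= expr1n mulr1 exprVn.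
Qed.
Lemma Uq_hf : h * f = q ^- 2 *: (f * h).
Proof.
have := qcM (qcX 2 (qcVf q0 n1 n2)) (qcX 2 (qcLf q n2 n2)).
by rewrite /= expr1n mul1r exprVn.
Qed.
Lemma Uq_e1f2 : e * f = f * e.
Proof. by apply/eqP; rewrite -subr_eq0 (Uq_ef r) mul0r scale0r. Qed.
Lemma comul_h' : comul h' = h' ⊗ h' :> tens U U.
Proof. by rewrite rmorphM !rmorphXn /= !comul_ugen /= !expr2 !tensM. Qed.

Hypothesis p_nroot1 : forall n, (q ^- 2) ^+ n.+1 != 1.
Variable zeta : fps K.
Hypothesis zeta0 : zeta 0%N = 0.

Let p0 : q ^- 2 != 0. Proof. by rewrite invr_eq0 expf_neq0. Qed.
(** This is the hypothesis [kp] for p = q^-2. It also shows that (1-p) x1 has no pole at q = 1. *)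
Lemma q2_scalar : (1 - q ^- 2) * (1 - q ^+ 2)^-1 = - q ^- 2.
Proof.
have q21 : 1 - q ^+ 2 != 0.
  by rewrite subr_eq0 eq_sym -invr_eq1 -[_^-1]expr1.
by field; rewrite q21 q0.
Qed.

Lemma FCG_twist : is_twist (FCG qs zeta).
Proof.
rewrite FCGE; apply: (@gaugedF_twist K (Uq q) _ _ p_nroot1 e f h).
- exact: comul_ugen.
- exact: comul_ugen.
- exact: counit_ugen.
- exact: counit_ugen.
- exact: Uq_he.
- exact: Uq_hf.
- exact: Uq_e1f2.
- exact: zeta0.
Qed.

Lemma FCG_factor : FCG qs zeta =
  fps_series (fun n => (qfact (q ^- 2) n)^-1 *:
    qpoch (q ^- 2) (- (fpsV (1 + (1 - q ^- 2) *:
        fpsZC zeta ((1 - q ^+ 2)^-1 *: tinl (e * h')))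
      * fpsZC fpsT ((1 - q ^+ 2)^-1 *: tinl f))) (fpsZC 1 (tinr h)) n)
  * fps_series (fun n => (qfact (q ^+ 2) n)^-1 *:
    qpoch (q ^+ 2) (fpsZC zeta ((1 - q ^+ 2)^-1 *: tinl (e * h')))
      (fpsZC 1 (tinr h')) n).
Proof.
have comul_e : comul e = h ⊗ e + e ⊗ 1 :> tens U U by exact: comul_ugen.
have comul_f : comul f = f ⊗ h + 1 ⊗ f :> tens U U by exact: comul_ugen.
rewrite FCGE (gaugedFE p_nroot1 p0 q2_scalar comul_e comul_f comul_h' Uq_he
  Uq_hf Uq_e1f2 Uq_hh' Uq_h'h zeta0).
by rewrite invrK.
Qed.
End CartanElements.

(** * Regularity at q = 1 *)

Section Regularity.
Variables (K : fieldType) (qs : {x : K | x != 0}) (S : K -> Prop).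
Local Notation q := (val qs).
Local Notation U := (Uq q).
Local Notation L i := (ugen (LL i) : U).
Local Notation L' i := (ugen (LV i) : U).
Local Notation e := (ugen (Ee n1) : U).
Local Notation f := (ugen (Ff n2) : U).
Local Notation h := (L' n1 ^+ 2 * L n2 ^+ 2).
Local Notation h' := (L n1 ^+ 2 * L' n2 ^+ 2).
Local Notation Uhat := (Uhat S).
Local Notation Uhat2 := (Uhat2 S).
Hypotheses (S0 : S 0) (S1 : S 1) (Sq : S q).
Hypotheses (SN : forall x, S x -> S (- x)).
Hypotheses (SD : forall x y, S x -> S y -> S (x + y)).
Hypotheses (SM : forall x y, S x -> S y -> S (x * y)).
Hypotheses (q1 : q - 1 != 0) (SqV : S q^-1) (SqD : S (1 + q)^-1).
Let r := @Uq_relP K q.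

(** Two such elements differ by a multiple of q - 1 in [Uhat], which is what cancels a simple pole.
    Cartan elements and powers of q are of this kind. *)
Definition near1 (u : U) := Uhat u /\ Uhat ((q - 1)^-1 *: (u - 1)).

Lemma near1M u v : near1 u -> near1 v -> near1 (u * v).
Proof.
move=> [hu hu1] [hv hv1]; split; first exact: subalg_mul.
have -> : u * v - 1 = (u - 1) * v + (v - 1).
  by rewrite mulrBl mul1r addrA subrK.
rewrite scalerDr scalerAl; apply: subalg_add => //.
exact: subalg_mul.
Qed.

Lemma near1_1 : near1 1.
Proof.
split; first exact: (Uhat1 qs S1).
rewrite subrr scaler0 -[0](scale0r 1); exact: subalg_const.
Qed.

Lemma near1X u n : near1 u -> near1 (u ^+ n).
Proof.
move=> hu; elim: n => [|n ih]; first by rewrite expr0; apply: near1_1.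
by rewrite exprS; apply: near1M.
Qed.

Lemma near1_L i : near1 (L i).
Proof.
split; last exact: subalg_gen (Uhat_L _ _).
exact: (Uhat_LL S1 Sq SN SD q1).
Qed.

Lemma near1V u v : u * v = 1 -> near1 u -> Uhat v -> near1 v.
Proof.
move=> uv [_ hu1] hv; split=> //.
have -> : v - 1 = - ((u - 1) * v) by rewrite mulrBl uv mul1r opprB.
rewrite scalerN -scaleN1r; apply: (UhatZ (SN S1)).
by rewrite scalerAl; apply: subalg_mul.
Qed.

Lemma near1_LV i : near1 (L' i).
Proof.
apply: near1V (Uq_LLV r i) (near1_L i) _; exact: subalg_gen (Uhat_LV _ _).
Qed.

Lemma near1_q : near1 q%:A.
Proof.
split; first exact: subalg_const.
have -> : q%:A - 1 = (q - 1) *: 1 :> U by rewrite scalerBl scale1r.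
by rewrite scalerA mulVf //; apply: subalg_const.
Qed.

Lemma near1_qV : near1 (q^-1)%:A.
Proof.
apply: near1V near1_q _; last exact: subalg_const.
by rewrite -scalerAl mul1r scalerA mulfV ?scale1r //; exact: (valP qs).
Qed.

Lemma near1_scalarX a n : near1 a%:A -> near1 (a ^+ n)%:A.
Proof. by move=> /(near1X n); rewrite exprZn expr1n. Qed.

(** As 1 - q^2 = -(q - 1)(1 + q) with 1/(1 + q) in [S], only the division by q - 1 matters. *)
Lemma near1_sub u v : near1 u -> near1 v -> Uhat ((1 - q ^+ 2)^-1 *: (u - v)).
Proof.
move=> [_ hu] [_ hv].
have -> : (1 - q ^+ 2)^-1 *: (u - v)
    = - (1 + q)^-1 *: ((q - 1)^-1 *: (u - 1))
      + (1 + q)^-1 *: ((q - 1)^-1 *: (v - 1)).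
  rewrite scaleNr [RHS]addrC -!scalerBr opprB addrA subrK.
  rewrite -[v - u]opprB !scalerN scalerA -scaleNr; congr (_ *: _).
  by rewrite -invfM -invrN; congr (_^-1); ring.
by apply: subalg_add; apply: UhatZ => //; apply: SN.
Qed.

Lemma Uhat2Z k (x : tens U U) : S k -> Uhat2 x -> Uhat2 (k *: x).
Proof.
move=> Sk hx; rewrite -[x]mul1r scalerAl; apply: Uhat2M => //.
rewrite -[1]/(1 ⊗ 1) -pureZl; apply: Uhat2_pure; first exact: subalg_const.
exact: (Uhat1 qs S1).
Qed.

Definition fps_Uhat2 (x : fps (tens U U)) := forall m, Uhat2 (x m).

Lemma fps_Uhat2M (x y : fps (tens U U)) :
  fps_Uhat2 x -> fps_Uhat2 y -> fps_Uhat2 (x * y).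
Proof. by move=> hx hy m; apply: Uhat2_sum => i; apply: Uhat2M. Qed.

Lemma fps_Uhat2Z k (x : fps (tens U U)) :
  S k -> fps_Uhat2 x -> fps_Uhat2 (k *: x).
Proof. by move=> Sk hx m; apply: Uhat2Z. Qed.

Lemma fps_Uhat2N (x : fps (tens U U)) : fps_Uhat2 x -> fps_Uhat2 (- x).
Proof. by move=> hx; rewrite -scaleN1r; apply: fps_Uhat2Z => //; apply: SN. Qed.

Lemma fps_Uhat2D (x y : fps (tens U U)) :
  fps_Uhat2 x -> fps_Uhat2 y -> fps_Uhat2 (x + y).
Proof. by move=> hx hy m; apply: Uhat2D. Qed.

Lemma fps_Uhat2_ZC (z : fps K) (v : tens U U) :
  (forall m, S (z m)) -> Uhat2 v -> fps_Uhat2 (fpsZC z v).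
Proof. by move=> hz hv m; apply: Uhat2Z. Qed.

Lemma fps_Uhat2_1 : fps_Uhat2 1.
Proof.
rewrite -fpsZC1; apply: fps_Uhat2_ZC => [m|].
  by rewrite fps1; case: eqP.
by apply: Uhat2_pure; apply: (Uhat1 qs S1).
Qed.

Lemma fps_Uhat2_qpoch c (x Y : fps (tens U U)) n :
  (forall i, fps_Uhat2 (x * (Y - (c ^+ i)%:A))) -> fps_Uhat2 (qpoch c x Y n).
Proof.
move=> hF; elim: n => [|n ih]; last by rewrite qpochS; apply: fps_Uhat2M.
by rewrite /qpoch big_ord0; apply: fps_Uhat2_1.
Qed.

Lemma fps_Uhat2_series (u : nat -> fps (tens U U)) :
  (forall n, fps_Uhat2 (u n)) -> fps_Uhat2 (fps_series u).
Proof. by move=> hu m; apply: Uhat2_sum => i; apply: hu. Qed.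

Lemma fps_Uhat2V (x : fps (tens U U)) : fps_Uhat2 x -> fps_Uhat2 (fpsV x).
Proof.
move=> hx; apply: fps_Uhat2_series; elim=> [|n ih].
  by rewrite expr0; apply: fps_Uhat2_1.
rewrite exprS; apply: fps_Uhat2M ih.
by apply: fps_Uhat2D (fps_Uhat2N hx); apply: fps_Uhat2_1.
Qed.

(** This handles one factor of [qpoch]: the polar scalar of the first leg moves across the tensor
    sign and is absorbed by u - c in the second. *)
Lemma fps_Uhat2_qfactor (z : fps K) (v u : U) c :
  (forall m, S (z m)) -> Uhat v -> near1 u -> near1 c%:A ->
  fps_Uhat2 (fpsZC z ((1 - q ^+ 2)^-1 *: tinl v) * (fpsZC 1 (tinr u) - c%:A)).
Proof.
move=> hz hv hu hc.
have -> : fpsZC 1 (tinr u) - c%:A = fpsZC 1 (tinr (u - c%:A)) :> fps (tens U U).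
  have -> : tinr (u - c%:A) = tinr u - c *: (1 : tens U U).
    by rewrite raddfB; congr (_ - _); apply: linearZ.
  apply: fpsP => m; rewrite fpsD fpsN fpsZ /=.
  by case: eqP => _; rewrite ?scale1r ?scale0r ?scaler0 ?subr0.
rewrite fpsZCM mulr1 -scalerAl tensM mul1r mulr1 -pureZr.
by apply: fps_Uhat2_ZC => //; apply: Uhat2_pure => //; apply: near1_sub.
Qed.

Hypothesis p_nroot1 : forall n, (q ^- 2) ^+ n.+1 != 1.
Hypothesis Sfact : forall n, S (qfact (q ^- 2) n)^-1.
Hypothesis SfactV : forall n, S (qfact (q ^+ 2) n)^-1.

Lemma FCG_regular (zeta : fps K) : zeta 0%N = 0 -> (forall m, S (zeta m)) ->
  fps_Uhat2 (FCG qs zeta).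
Proof.
move=> zeta0 Szeta; rewrite FCG_factor //.
have Se : Uhat e by exact: subalg_gen (Uhat_e _ _).
have Sf : Uhat f by exact: subalg_gen (Uhat_f _ _).
have Sh : near1 h.
  by apply: near1M; apply: near1X; [exact: near1_LV|exact: near1_L].
have Sh' : near1 h'.
  by apply: near1M; apply: near1X; [exact: near1_L|exact: near1_LV].
have SE : Uhat (e * h') by apply: subalg_mul => //; case: Sh'.
apply: fps_Uhat2M; apply: fps_Uhat2_series => n; apply: fps_Uhat2Z => //;
  apply: fps_Uhat2_qpoch => i.
(* The inverse series is regular because, by [q2_scalar], its argument is 1 - q^-2 zeta E in the
   first leg; the pole of the other factor is cancelled by h - p^i. *)
- rewrite mulNr -mulrA; apply/fps_Uhat2N/fps_Uhat2M.
    apply/fps_Uhat2V/fps_Uhat2D; first exact: fps_Uhat2_1.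
    rewrite -fpsZCr scalerA q2_scalar //; apply: fps_Uhat2_ZC => //.
    rewrite -[_ *: _]pureZl; apply: Uhat2_pure; last exact: (Uhat1 qs S1).
    by apply: UhatZ => //; apply: SN; rewrite -exprVn expr2; apply: SM.
  apply: fps_Uhat2_qfactor => //.
    by move=> m; rewrite /=; case: eqP.
  apply: near1_scalarX; rewrite -exprVn; apply: near1_scalarX; exact: near1_qV.
- apply: fps_Uhat2_qfactor => //.
  apply: near1_scalarX; apply: near1_scalarX; exact: near1_q.
Qed.
End Regularity.

(** * Rational functions regular at q = 1 *)

Section RegularFunctions.
Variable R : realType.
Local Notation q := (val (qvar R)).
Local Notation "x %:F" := (tofrac x).

Lemma regular1_polyV (a : {poly R[i]}) : a.[1] != 0 -> regular1 (a%:F)^-1.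
Proof. by move=> a1; exists 1, a; rewrite rmorph1 mul1r. Qed.

Lemma qvarX n : q ^+ n = ('X^n : {poly R[i]})%:F.
Proof. by rewrite rmorphXn. Qed.

Lemma qvar_nroot1 n : (q ^+ 2) ^+ n.+1 != 1.
Proof.
rewrite -exprM qvarX -(rmorph1 (@tofrac {poly R[i]})) tofrac_eq.
apply/eqP => /(congr1 (fun a : {poly R[i]} => size a)).
by rewrite size_polyXn size_poly1 mulnS.
Qed.

Lemma qvarV_nroot1 n : (q ^- 2) ^+ n.+1 != 1.
Proof. by rewrite exprVn invr_eq1 qvar_nroot1. Qed.

Lemma qnum_qvar n :
  qnum (q ^+ 2) n.+1 = (\sum_(i < n.+1) 'X^(2 * i) : {poly R[i]})%:F.
Proof.
have q21 : 1 - q ^+ 2 != 0.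
  by rewrite subr_eq0 eq_sym -[q ^+ 2]expr1 qvar_nroot1.
apply: (mulIf q21); rewrite /qnum mulfVK //.
rewrite -[LHS]opprB subrX1 -mulNr opprB mulrC rmorph_sum; congr (_ * _).
by apply: eq_bigr => i _; rewrite -exprM qvarX.
Qed.

(** The q-integer is a polynomial with value n+1 at q = 1, which is nonzero in characteristic 0. *)
Lemma regular1_qnumV n : regular1 (qnum (q ^+ 2) n.+1)^-1.
Proof.
rewrite qnum_qvar; apply: regular1_polyV; rewrite horner_sum.
under eq_bigr do rewrite hornerXn expr1n.
by rewrite sumr_const card_ord Num.Theory.pnatr_eq0.
Qed.

Lemma regular1_qfactV n : regular1 (qfact (q ^+ 2) n)^-1.
Proof.
elim: n => [|n ih]; first by rewrite qfact0 invr1; apply: regular1_1.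
by rewrite qfactS invfM; apply: regular1M ih; apply: regular1_qnumV.
Qed.

(** By [qnumV], inverting the base changes each inverse q-integer only by a nonnegative power of
    q. *)
Lemma regular1_qfactVV n : regular1 (qfact (q ^- 2) n)^-1.
Proof.
elim: n => [|n ih]; first by rewrite qfact0 invr1; apply: regular1_1.
rewrite qfactS invfM; apply: regular1M ih.
have q20 : q ^+ 2 != 0 by rewrite expf_neq0 ?(valP (qvar R)).
rewrite (qnumV qvar_nroot1 n q20) (invfM (_ ^- n)) invrK.
apply: regular1M (regular1_qnumV n).
rewrite -exprM qvarX; exact: regular1_poly.
Qed.
End RegularFunctions.

Theorem proposition7 (R : realType) (zeta : fps (Cq R)) :
  in_tS (@regular1 R) zeta ->
  (forall m : nat, Uhat2 (@regular1 R) (FCG (qvar R) zeta m)) /\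
  is_twist (FCG (qvar R) zeta).
Proof.
case=> y regular_y zetaE.
(* The vanishing constant term makes the q-exponentials in zeta well-behaved t-adic sums. *)
have zeta0 : zeta 0%N = 0 by rewrite zetaE fpsM big_ord1 mul0r.
have regular_zeta m : regular1 (zeta m).
  rewrite zetaE fpsM; elim/big_ind: _ => [|u v|i _].
  - exact: regular1_0.
  - exact: regular1D.
  - apply: regular1M (regular_y _) => /=.
    by case: eqP => _; [apply: regular1_1|apply: regular1_0].
split; last exact: FCG_twist (@qvarV_nroot1 R) _ zeta0.
apply: (FCG_regular (@regular1_0 R) (@regular1_1 R) (@regular1_q R)
  (@regular1N R) (@regular1D R) (@regular1M R) (qvar_neq1 R)) => //.
- by apply: regular1_polyV; rewrite hornerX oner_eq0.
(* The polynomial 1 + q takes the nonzero value 2 at q = 1. *)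
- have -> : 1 + val (qvar R) = tofrac (1 + 'X : {poly R[i]}).
    by rewrite rmorphD rmorph1.
  by apply: regular1_polyV; rewrite !hornerE (Num.Theory.pnatr_eq0 _ 2).
- exact: qvarV_nroot1.
- exact: regular1_qfactVV.
- exact: regular1_qfactV.
Qed.
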